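(* Let $e>1$ be odd, $t\ge0$, $\mathbf c=(t+(1-e)/2,0)$. Let $\lambda$ be a partition with $2$-core $\Delta_t$ and put $\mu=\bar\lambda^{(2)}$. Assume $|\mu,\mathbf c\rangle$ is a highest weight vertex of $\mathcal G_{\mathbf c,e}$; then the $e$-core of $\lambda$ is a $2$-core $\Delta_s$ for some $s\ge0$. Put $\mathbf s=(s+(1-e)/2,0)$. Then there is a graph isomorphism between the connected component $B(\mu,\mathbf c)$ of $\mathcal G_{\mathbf c,e}$ containing $|\mu,\mathbf c\rangle$ and the connected component $B((\emptyset,\emptyset),\mathbf s)$ of $\mathcal G_{\mathbf s,e}$ containing $|(\emptyset,\emptyset),\mathbf s\rangle$, up to a shift of the labels of the arrows (i.e. there is $d\in\mathbb Z$ such that edges of colour $i$ correspond to edges of colour $i+d\bmod e$).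
   Context: Crystal graph $\mathcal G_{\mathbf d,e}$ ($\mathbf d=(d_1,d_2)\in\mathbb Z^2$): vertices $|\nu,\mathbf d\rangle$, $\nu$ a bipartition; nodes $(a,b,j)$ of $\nu^j$ (row $a$, column $b$) have content $b-a+d_j$ and residue content mod $e$; for residue $i$ order addable and removable $i$-nodes by increasing content, ties broken with larger $j$ first, form the word in $A$ (addable)/$R$ (removable), cancel consecutive $RA$ recursively to get $A^\alpha R^\beta$; the good addable $i$-node is that of the rightmost $A$; edge $|\nu,\mathbf d\rangle\xrightarrow{i}|\nu',\mathbf d\rangle$ iff $\nu'$ is $\nu$ plus its good addable $i$-node. Highest weight vertex: no incoming edges. $\Delta_t=(t,\dots,1)$. For a partition $\lambda$ with $\beta$-set $B$ of odd size, $\lambda^{(2)}=(\pi\{x/2:x\in B\text{ even}\},\pi\{(x-1)/2:x\in B\text{ odd}\})$, $\pi(X)$ the partition with $\beta$-set $X$; if $\lambda$ has $2$-core $\Delta_t$, $\bar\lambda^{(2)}=\lambda^{(2)}$ for $t$ even and the swapped pair for $t$ odd. *)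

(* Defs.v *)
From mathcomp Require Import all_boot all_order all_algebra.
From Stdlib Require Import Relation_Operators.
Set Implicit Arguments. Unset Strict Implicit. Unset Printing Implicit Defensive.
Import Order.TTheory GRing.Theory Num.Theory.

Definition is_partition (la : seq nat) : bool :=
  sorted geq la && all (fun x => 0 < x)%N la.

Definition Delta (t : nat) : seq nat := rev (iota 1 t).

Definition beta_set (N : nat) (la : seq nat) : seq nat :=
  [seq (nth 0 la i + (N - 1 - i))%N | i <- iota 0 N].

Definition part_of_beta (X : seq nat) : seq nat :=
  let s := sort geq (undup X) in
  [seq x <- [seq (nth 0 s i - (size s - 1 - i))%N | i <- iota 0 (size s)]
     | (0 < x)%N].

(* p-core via the p-abacus: slide all beads on each runner upward. *)
Definition core (p : nat) (la : seq nat) : seq nat :=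
  let B := beta_set (size la) la in
  part_of_beta
    (flatten [seq [seq (r + p * k)%N | k <- iota 0 (count (fun x => x %% p == r) B)]
             | r <- iota 0 p]).

Definition odd_beads (la : seq nat) : nat :=
  if odd (size la) then size la else (size la).+1.

Definition bipart := (seq nat * seq nat)%type.

Definition is_bipartition (nu : bipart) : bool :=
  is_partition nu.1 && is_partition nu.2.

Definition quot2 (la : seq nat) : bipart :=
  let B := beta_set (odd_beads la) la in
  (part_of_beta [seq x./2 | x <- B & ~~ odd x],
   part_of_beta [seq x.-1./2 | x <- B & odd x]).

(* bar la^(2), for la with 2-core Delta_t *)
Definition barquot2 (t : nat) (la : seq nat) : bipart :=
  let q := quot2 la in if odd t then (q.2, q.1) else q.

Local Open Scope ring_scope.

(* a node: (addable?, component j in {0,1}, row a, content) ;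
   components 0,1 correspond to nu^1, nu^2 of the paper. *)
Record node := Node { is_add : bool; comp : nat; row : nat; cont : int }.

Definition dcomp (d : int * int) (j : nat) : int := if j == 0%N then d.1 else d.2.

Definition part_comp (nu : bipart) (j : nat) : seq nat := if j == 0%N then nu.1 else nu.2.

(* content of box (a,b) (0-indexed row a, column b) of component j *)
Definition content (d : int * int) (j a b : nat) : int := b%:Z - a%:Z + dcomp d j.

Definition addable_nodes (d : int * int) (j : nat) (la : seq nat) : seq node :=
  [seq Node true j a (content d j a (nth 0 la a))
  | a <- iota 0 (size la).+1 & (a == 0%N) || (nth 0 la a < nth 0 la a.-1)%N].

Definition removable_nodes (d : int * int) (j : nat) (la : seq nat) : seq node :=
  [seq Node false j a (content d j a (nth 0 la a).-1)
  | a <- iota 0 (size la) & (nth 0 la a.+1 < nth 0 la a)%N].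

Definition node_le (x y : node) : bool :=
  (cont x < cont y) || ((cont x == cont y) && (comp y <= comp x)%N).

Definition has_res (e : nat) (i : int) (x : node) : bool :=
  ((cont x - i) %% e%:Z)%Z == 0.

Definition iword (d : int * int) (e : nat) (i : int) (nu : bipart) : seq node :=
  sort node_le
    [seq x <- addable_nodes d 0 nu.1 ++ removable_nodes d 0 nu.1
              ++ addable_nodes d 1 nu.2 ++ removable_nodes d 1 nu.2
      | has_res e i x].

Fixpoint cancelRA (w : seq node) : seq node :=
  match w with
  | x :: ((y :: w'') as w') =>
      if ~~ is_add x && is_add y then w'' else x :: cancelRA w'
  | _ => w
  end.

(* recursively cancel RA pairs (size w iterations suffice) *)
Definition reduce_word (w : seq node) : seq node := iter (size w) cancelRA w.

Definition good_node (d : int * int) (e : nat) (i : int) (nu : bipart) : option node :=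
  let As := [seq x <- reduce_word (iword d e i nu) | is_add x] in
  if As is x :: _ then Some (last x As) else None.

Definition add_node (nu : bipart) (x : node) : bipart :=
  if comp x == 0%N then (incr_nth nu.1 (row x), nu.2)
  else (nu.1, incr_nth nu.2 (row x)).

(* edge |nu,d> --i--> |nu',d> in G_{d,e}; colours i are taken modulo e *)
Definition edge (d : int * int) (e : nat) (nu : bipart) (i : int) (nu' : bipart) : Prop :=
  is_bipartition nu /\ exists x, good_node d e i nu = Some x /\ nu' = add_node nu x.

Definition highest_weight (d : int * int) (e : nat) (mu : bipart) : Prop :=
  ~ exists nu i, edge d e nu i mu.

Definition component (d : int * int) (e : nat) (mu nu : bipart) : Prop :=
  is_bipartition mu /\
  clos_refl_sym_trans bipart (fun x y => exists i, edge d e x i y) mu nu.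

Definition component_iso (c s : int * int) (e : nat) (x y : bipart)
    (f : bipart -> bipart) (dsh : int) : Prop :=
  [/\ forall nu, component c e x nu -> component s e y (f nu),
      forall nu1 nu2, component c e x nu1 -> component c e x nu2 ->
        f nu1 = f nu2 -> nu1 = nu2,
      forall nu', component s e y nu' -> exists2 nu, component c e x nu & f nu = nu'
    & forall nu1 nu2 (i : int), component c e x nu1 -> component c e x nu2 ->
        (edge c e nu1 i nu2 <-> edge s e (f nu1) (i + dsh) (f nu2))].

(* the charge (t + (1-e)/2, 0) for odd e *)
Definition charge (t e : nat) : int * int := (t%:Z - (e.-1./2)%:Z, 0).

(* Main.v *)
(** A simply laced crystal with a single source is determined, by Stembridge's local
    axioms, by the weight of the source: two such crystals are compared by following
    parallel paths from the sources, and the axioms propagate the matching to the next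
    rank.  For e >= 3 the graph G_(d,e) satisfies the axioms: in terms of bead
    configurations, the words for colours i and i + 1 live on the same ordered set of
    windows of three consecutive positions, so the axioms for this pair reduce to
    words in the letters of minuscule A_2-crystals and follow by induction on the word,
    while nonadjacent colours move disjoint sets of beads.

    It remains to compare weights.  Interleaving the two components of mu recovers the
    bead configuration of la, with colour i moving beads from x to x + 2 for x in one
    class mod e.  If mu is a source, each class of x contains at least as many beads as
    the class of x + 2, so the e-core of la is closed under moving beads from x to
    x - 2; such a diagram is that of some Delta_s.  Passing to the e-core preserves the
    bead counts of the classes, hence mu and the empty bipartition with the charge of
    s have the same weight up to a rotation of the colours. *)

From mathcomp Require Import all_boot all_order all_algebra zify.
From Stdlib Require Import Relation_Operators ClassicalEpsilon.
Require Import Defs.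
Set Implicit Arguments. Unset Strict Implicit. Unset Printing Implicit Defensive.
Import Order.TTheory GRing.Theory Num.Theory.

(** * Signature words of rank two *)

(** The delicate point of the matching is that parallel vertices may have further incoming edges,
    which must correspond. For two edges into one vertex the axioms supply a common ancestor of
    lower rank; there the two sides agree by induction, so the square or octagon can be rebuilt on
    the other side. The choice between the two shapes has to be made at that ancestor, from [phi]
    alone, which is why confluence comes with the outcome of the test there and not at the common
    target. Confluence costs no second analysis of words: duality of letters turns it into the
    ascending square or octagon, and only the test has to be carried over.

    Bead configurations are infinite, so words and bead counts are cut off at a parameter [K]; an
    edge may enlarge the cut-off by 2, and identities of vertices are proved at one common [K].

    Oddness of [e] matters twice beyond making the charge integral: with [1 < e] it gives [3 <= e],
    so that windows of three positions do not overlap; and a shift by [e] changes parity, so that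
    weights, which see one parity class of positions, control both. *)

Section Signature.
Variables (T : Type) (A R : T -> bool).

(* For a word reducing to A^alpha R^beta under cancellation of factors RA, nA is
   alpha, nR is beta, and good is the rightmost surviving A. *)
Fixpoint nA (w : seq T) : nat :=
  if w is x :: w' then A x + (nA w' - R x) else 0.
Fixpoint nR (w : seq T) : nat :=
  if w is x :: w' then nR w' + (R x - nA w') else 0.
Fixpoint good (w : seq T) : option T :=
  if w is x :: w' then
    if R x < nA w' then good w' else if A x then Some x else None
  else None.

(** A cancelled pair consists of one A and one R. Written additively because subtraction on [nat]
    truncates; this difference of counts is the weight of the word. *)
Lemma nA_nR_count w : nA w + count R w = nR w + count A w.
Proof. elim: w => //= x w IH; lia. Qed.

Lemma nA_rcons w x : nA (rcons w x) = nA w + (A x - nR w).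
Proof.
elim: w => /= [|y w IH]; first by lia.
have := nA_nR_count w; lia.
Qed.

Lemma nR_rcons w x : nR (rcons w x) = (nR w - A x) + R x.
Proof. elim: w => /= [|y w IH]; [lia|rewrite nA_rcons IH; lia]. Qed.

End Signature.

(** Reversing a word and exchanging A with R maps factors RA to factors RA, hence preserves
    cancellation. *)
Lemma nA_rev T (A R : T -> bool) w : nA A R (rev w) = nR R A w.
Proof.
suff [] : nA A R (rev w) = nR R A w /\ nR A R (rev w) = nA R A w by [].
elim: w => //= x w [IH1 IH2]; rewrite rev_cons nA_rcons nR_rcons IH1 IH2.
by split; lia.
Qed.

(* The letter at content c of a component records which of c, c + 1, c + 2 carry
   beads.  Colour false moves a bead from c to c + 1, colour true from c + 1 to c + 2,
   so that words of letters form a tensor product of minuscule A_2-crystals. *)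
Definition letter := (bool * bool * bool)%type.
Definition upper (i : bool) (l : letter) := let: (a, b, c) := l in
  if i then b && ~~ c else a && ~~ b.
Definition lower (i : bool) (l : letter) := let: (a, b, c) := l in
  if i then ~~ b && c else ~~ a && b.
Definition shift (i : bool) (l : letter) : letter := let: (a, b, c) := l in
  if i then (a, c, b) else (b, a, c).

Notation ph i w := (nA (upper i) (lower i) w).
Notation ep i w := (nR (upper i) (lower i) w).

(* The Kashiwara operator f_i; its value is junk when ph i w = 0. *)
Fixpoint fop (i : bool) (w : seq letter) : seq letter :=
  if w is l :: w' then
    if lower i l < ph i w' then l :: fop i w' else shift i l :: w'
  else [::].

Lemma fop_same i w : 0 < ph i w ->
  ph i w = (ph i (fop i w)).+1 /\ ep i (fop i w) = (ep i w).+1.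
Proof.
elim: w => [|[[[] []] []] w IH] //=; case: i IH => /= IH;
rewrite ?[0 < ph _ w]lt0n; try case: ifP => /=; lia.
Qed.

(** The Cartan entry of adjacent colours is -1: [ph - ep] of the other colour rises by one, and only
    one of the two terms changes. *)
Lemma fop_other i w : 0 < ph i w ->
  (ph (~~ i) (fop i w) = (ph (~~ i) w).+1 /\ ep (~~ i) (fop i w) = ep (~~ i) w) \/
  (ph (~~ i) (fop i w) = ph (~~ i) w /\ ep (~~ i) w = (ep (~~ i) (fop i w)).+1).
Proof.
elim: w => [|[[[] []] []] w IH] //=; case: i IH => /= IH;
try case: ifP => /=; lia.
Qed.

(* Along f_i, either phi of the other colour increases or its eps decreases. *)
Definition inc i w := ph (~~ i) (fop i w) == (ph (~~ i) w).+1.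

Lemma inc_other i w : 0 < ph i w -> inc i w -> ~~ inc (~~ i) (fop i w).
Proof.
rewrite /inc negbK.
elim: w => [|[[[] []] []] w IH] //=; have := @fop_same i w; have := @fop_other i w;
have := @fop_same (~~ i) w; have := @fop_other (~~ i) w; rewrite ?negbK;
case: i IH => /= IH H1 H2 H3 H4;
repeat (case: ifP => /= ?); lia.
Qed.

(** Along a string of colour [i] the test [inc] never turns off again. [octagon_mix] needs this when
    [i] can act twice inside the tail. *)
Lemma inc_same i w : 0 < ph i w -> inc i w -> 0 < ph i (fop i w) -> inc i (fop i w).
Proof.
rewrite /inc.
elim: w => [|[[[] []] []] w IH] //=; have := @fop_same i w; have := @fop_other i w;
have := @fop_same i (fop i w); have := @fop_other i (fop i w);
case: i IH => /= IH H1 H2 H3 H4;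
repeat (case: ifP => /= ?); lia.
Qed.

Lemma fop_square i w : 0 < ph i w -> 0 < ph (~~ i) w ->
  ~~ (inc i w && inc (~~ i) w) -> fop i (fop (~~ i) w) = fop (~~ i) (fop i w).
Proof.
rewrite /inc negbK.
elim: w => [|[[[] []] []] w IH] //=; have := @fop_same i w; have := @fop_other i w;
have := @fop_same (~~ i) w; have := @fop_other (~~ i) w; rewrite ?negbK;
case: i IH => /= IH H1 H2 H3 H4;
repeat (case: ifP => /= ?); move=> *;
first [by []| exfalso; lia | (congr (_ :: _); apply: IH; lia) | idtac].
all: try lia.
Qed.

Lemma fop_in i l w : lower i l < ph i w -> fop i (l :: w) = l :: fop i w.
Proof. by move=> /= ->. Qed.

Lemma fop_out i l w : ph i w <= lower i l -> fop i (l :: w) = shift i l :: w.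
Proof. by move=> /=; rewrite ltnNge => ->. Qed.

(** The two equalities for [ph] strengthen the induction on words: they decide whether the fourth
    operator passes a letter put in front. *)
Definition octagon i w :=
  fop i (fop (~~ i) (fop (~~ i) (fop i w))) = fop (~~ i) (fop i (fop i (fop (~~ i) w))) /\
  ph i (fop (~~ i) (fop (~~ i) (fop i w))) = ph i w /\
  ph (~~ i) (fop i (fop i (fop (~~ i) w))) = ph (~~ i) w.

Lemma octagon_sym i w : octagon (~~ i) w -> octagon i w.
Proof. by rewrite /octagon negbK => -[-> [-> ->]]. Qed.

Lemma octagon_in i l w : lower i l < ph i w -> lower (~~ i) l < ph (~~ i) w ->
  inc i w -> inc (~~ i) w -> octagon i w -> octagon i (l :: w).
Proof.
move=> Hi Hj Ii Ij [E1 [E2 E3]].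
have Gi := inc_other (leq_ltn_trans (leq0n _) Hi) Ii.
have Gj := inc_other (leq_ltn_trans (leq0n _) Hj) Ij.
rewrite /inc ?negbK in Ii Ij Gi Gj.
have [Fi _] := @fop_same i w (leq_ltn_trans (leq0n _) Hi).
have [Fj _] := @fop_same (~~ i) w (leq_ltn_trans (leq0n _) Hj).
have [|Fij _] := @fop_same (~~ i) (fop i w); first lia.
have [|Fji _] := @fop_same i (fop (~~ i) w); first lia.
rewrite /octagon (fop_in Hi) (fop_in Hj).
rewrite (@fop_in (~~ i) l (fop i w)) 1?(@fop_in i l (fop (~~ i) w)); try lia.
rewrite (@fop_in (~~ i) l (fop (~~ i) (fop i w))) 1?(@fop_in i l (fop i (fop (~~ i) w))); try lia.
rewrite (@fop_in i) 1?(@fop_in (~~ i)); try lia.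
by rewrite E1 /= E2 E3.
Qed.

(** The two operators start at different places: [~~ i] moves the head, [i] acts in the tail. The
    tail has no arrow of colour [~~ i] at first and exactly one after [i] has acted, which fixes the
    position of every later step. *)
Lemma octagon_mix i l w : lower i l < ph i w -> ph (~~ i) w <= lower (~~ i) l ->
  upper (~~ i) l -> inc i w -> octagon i (l :: w).
Proof.
move=> Hi Hj Uj Ii.
have Gi := inc_other (leq_ltn_trans (leq0n _) Hi) Ii.
have [Fi _] := @fop_same i w (leq_ltn_trans (leq0n _) Hi).
have Ki := inc_same (leq_ltn_trans (leq0n _) Hi) Ii.
have Lj : lower (~~ i) l = false by case: (l) (i) Uj => [[[] []] []] [].
have qj : ph (~~ i) w = 0 by move: Hj; rewrite Lj; lia.
have := @fop_square i (fop i w).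
rewrite (negbTE Gi) andbF => SQ.
have := @fop_other (~~ i) (fop i w).
have := @fop_other i (fop i w).
rewrite /inc ?negbK in Ii Gi Ki.
rewrite negbK => Oii Oij.
have [|Fij _] := @fop_same (~~ i) (fop i w); first lia.
have Fii := @fop_same i (fop i w).
rewrite /octagon (fop_in Hi) (fop_out Hj).
rewrite (@fop_in (~~ i) l (fop i w)); last lia.
rewrite (@fop_out (~~ i) l (fop (~~ i) (fop i w))); last lia.
have Li' : lower i (shift (~~ i) l) = false by case: (l) (i) Uj => [[[] []] []] [].
have Lj' : lower (~~ i) (shift (~~ i) l) by case: (l) (i) Uj => [[[] []] []] [].
have Uj' : upper (~~ i) (shift (~~ i) l) = false by case: (l) (i) Uj => [[[] []] []] [].
have LU : lower i l = ~~ upper i (shift (~~ i) l) by case: (l) (i) Uj => [[[] []] []] [].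
have UU : upper i l = false by case: (l) (i) Uj => [[[] []] []] [].
have UA : upper i (shift (~~ i) l) ->
   lower (~~ i) (shift i (shift (~~ i) l)) = false /\
   upper (~~ i) (shift i (shift (~~ i) l)) = false
   by case: (l) (i) Uj => [[[] []] []] [].
have pj : ph (~~ i) (fop i w) = 1 by move: (eqP Ii); rewrite qj.
have pij : ph (~~ i) (fop (~~ i) (fop i w)) = 0 by move: Fij; rewrite pj => -[].
have pji : ph i (fop (~~ i) (fop i w)) = ph i (fop i w) by clear - Oij Gi pj; lia.
clear Hj Oij Gi Fij; rewrite qj pj in Ii Ki Oii SQ.
rewrite (@fop_in i (shift (~~ i) l) w); last by rewrite Li' Fi.
(* If the tail is exhausted for [i], the second step of colour [i] moves the head, which [~~ i] has
   already moved. Otherwise both steps stay in the tail and the square at [fop i w] closes the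
   diagram. *)
have [p0|p1] := posnP (ph i (fop i w)).
  have Ua : upper i (shift (~~ i) l).
    by move: Hi; rewrite LU Fi p0; case: (upper _ _).
  have [ua ub] := UA Ua.
  rewrite !(@fop_out i (shift (~~ i) l)) ?pji ?p0 //.
  rewrite fop_in; last by rewrite ua pj.
  split => //; rewrite /= ua ub Li' Lj Uj LU UU Ua ?pji ?p0 ?qj ?pj ?pij ?Fi ?p0; by split.
have [p2 _] := Fii p1.
have q2 : ph (~~ i) (fop i (fop i w)) = 2 by rewrite (eqP (Ki p1)).
rewrite !(@fop_in i (shift (~~ i) l)) ?Li' ?pji //.
rewrite !(@fop_in (~~ i) (shift (~~ i) l)) ?Lj' ?q2 //.
rewrite SQ ?pj //; split => //=.
rewrite Uj Lj Lj' Uj' UU LU Li' qj; rewrite q2 Fi.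
rewrite pji.
case: (upper _ _) => /=; clear; lia.
Qed.

Lemma fop_octagon i w : 0 < ph i w -> 0 < ph (~~ i) w -> inc i w -> inc (~~ i) w ->
  octagon i w.
Proof.
elim: w i => [|l w IH] i //= pi pj.
have [Hi|Hi] := ltnP (lower i l) (ph i w); have [Hj|Hj] := ltnP (lower (~~ i) l) (ph (~~ i) w).
- rewrite /inc ?negbK !fop_in //= => Ii Ij.
  have [|?|] := @fop_other i w; try lia.
  have := @fop_other (~~ i) w; rewrite negbK => Oj.
  by apply: octagon_in; rewrite // ?/inc ?negbK; try (apply: IH; rewrite /inc ?negbK); lia.
- rewrite /inc ?negbK (fop_in Hi) (fop_out Hj) //= => Ii Ij.
  have [|?|] := @fop_other i w; try lia.
  have Uj: upper (~~ i) l by lia.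
  by apply: octagon_mix => //; rewrite /inc; lia.
- rewrite /inc ?negbK (fop_in Hj) (fop_out Hi) //= => Ii Ij.
  have := @fop_other (~~ i) w; rewrite negbK => Oj.
  have Ui: upper i l by lia.
  by apply: octagon_sym; apply: octagon_mix; rewrite ?/inc ?negbK //; lia.
(* Both operators would move the head, but no letter is [upper] for both colours. *)
- exfalso. case: (l) (i) pi pj Hi Hj => [[[] []] []] [] /=; lia.
Qed.

Lemma nA_map T T' (A R : T -> bool) (g : T' -> T) w :
  nA A R (map g w) = nA (A \o g) (R \o g) w.
Proof. by elim: w => //= x w ->. Qed.

Lemma eq_nA T (A R A' R' : T -> bool) w : A =1 A' -> R =1 R' -> nA A R w = nA A' R' w.
Proof. by move=> eA eR; elim: w => //= x w ->; rewrite eA eR. Qed.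

Lemma nR_map T T' (A R : T -> bool) (g : T' -> T) w :
  nR A R (map g w) = nR (A \o g) (R \o g) w.
Proof. by rewrite -!nA_rev -map_rev nA_map. Qed.

Lemma eq_nR T (A R A' R' : T -> bool) w : A =1 A' -> R =1 R' -> nR A R w = nR A' R' w.
Proof. by move=> eA eR; rewrite -!nA_rev; apply: eq_nA. Qed.

(** * Duality between ascending and descending operators *)

Definition neg (l : letter) : letter := let: (a, b, c) := l in (~~ a, ~~ b, ~~ c).
(* Complementing letters and reversing words exchanges f_i with e_i. *)
Definition dual (w : seq letter) := rev (map neg w).

Lemma upper_neg i l : upper i (neg l) = lower i l.
Proof. by case: l i => [[[] []] []] []. Qed.
Lemma lower_neg i l : lower i (neg l) = upper i l.
Proof. by case: l i => [[[] []] []] []. Qed.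
Lemma neg_shift i l : shift i (neg l) = neg (shift i l).
Proof. by case: l i => [[[] []] []] []. Qed.
Lemma shiftK i l : shift i (shift i l) = l.
Proof. by case: l i => [[[] []] []] []. Qed.
Lemma lower_shift i l : lower i (shift i l) = upper i l.
Proof. by case: l i => [[[] []] []] []. Qed.

Lemma dualK : involutive dual.
Proof.
move=> w; rewrite /dual map_rev revK -map_comp map_id_in // => -[[a b] c] _ /=.
by rewrite !negbK.
Qed.

Lemma ph_dual i w : ph i (dual w) = ep i w.
Proof.
by rewrite nA_rev nR_map; apply: eq_nR => l /=; rewrite (upper_neg, lower_neg).
Qed.

Lemma ep_dual i w : ep i (dual w) = ph i w.
Proof. by rewrite -ph_dual dualK. Qed.

(** Duality moves the head of a word to its end, whereas [fop] recurses from the head. The last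
    letter moves exactly when it is an A that no surviving R before it cancels. *)
Lemma fop_rcons i w l : 0 < ph i (rcons w l) ->
  fop i (rcons w l) =
  if upper i l && (ep i w == 0) then rcons w (shift i l) else rcons (fop i w) l.
Proof.
rewrite nA_rcons.
elim: w => [|m w IH] /=; first by case: (upper i l) (lower i l) => [] [].
rewrite nA_rcons => H.
have Um : lower i m = true -> upper i m = false.
  by case: (m) (i) => [[[] []] []] [].
case: (ltnP (lower i m) (ph i w)) => h2.
  rewrite ifT; last by lia.
  rewrite IH; last by lia.
  have -> : lower i m - ph i w = 0 by lia.
  by rewrite addn0; case: ifP.
case: ifP => h1.
  have [ul e0 pm] : [/\ upper i l, ep i w = 0 & ph i w = lower i m].
    by case: (upper i l) h1 => h1; split; lia.
  rewrite IH; last by rewrite ul e0; lia.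
  by rewrite ul e0 pm subnn.
case: ifP => //= h3; exfalso; case/andP: h3 => ul; rewrite ul in h1 H; lia.
Qed.

(** This is e_i f_i = 1, with e_i realized as [dual] f_i [dual]. *)
Lemma fop_dual i w : 0 < ph i w -> fop i (dual (fop i w)) = dual w.
Proof.
have dualE l v : dual (l :: v) = rcons (dual v) (neg l) by rewrite /dual /= rev_cons.
elim: w => // l w IH H; have := fop_same H; move: H => /=.
case: ifP => h H [] h1 h2.
  rewrite !dualE fop_rcons; last first.
    by rewrite nA_rcons ph_dual; have := @fop_same i w; lia.
  rewrite ep_dual upper_neg IH; last by lia.
  by case: ifP => // /andP[ll /eqP p0]; have := @fop_same i w; rewrite ll in h; lia.
have [ul p0] : upper i l /\ ph i w = 0.
  by case: (l) (i) h H => [[[] []] []] [] /=; lia.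
have ll : lower i l = false by case: (l) (i) ul => [[[] []] []] [].
rewrite !dualE fop_rcons; last first.
  by rewrite nA_rcons upper_neg lower_shift ul ep_dual p0; lia.
by rewrite upper_neg lower_shift ul ep_dual p0 eqxx /= neg_shift shiftK.
Qed.

Lemma fop_inj i v w : 0 < ph i v -> 0 < ph i w -> fop i v = fop i w -> v = w.
Proof. by move=> /fop_dual hv /fop_dual hw e; apply: (can_inj dualK); rewrite -hv -hw e. Qed.

(** What the descending octagon needs: the operators along one side are defined, and the [ep] values
    at its last two corners, which duality reads as [ph] values. *)
Lemma octagon_stats i u : 0 < ph i u -> 0 < ph (~~ i) u -> inc i u -> inc (~~ i) u ->
  let v := fop (~~ i) (fop (~~ i) (fop i u)) in
  [/\ 0 < ph (~~ i) (fop i u), 0 < ph (~~ i) (fop (~~ i) (fop i u)), 0 < ph i v,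
      ep i (fop i v) = (ep i u).+1 & ep (~~ i) v = (ep (~~ i) u).+2].
Proof.
move=> pi pj Ii Ij v; have [_ [E2 _]] := fop_octagon pi pj Ii Ij.
have Gi := inc_other pi Ii; rewrite /inc negbK in Ii Gi; move/eqP: Ii => Ii.
have o1 := fop_other pi; have [a1 a2] := fop_same pi.
have q1 : 0 < ph (~~ i) (fop i u) by rewrite Ii.
have [b1 b2] := fop_same q1; have q2 : 0 < ph (~~ i) (fop (~~ i) (fop i u)) by lia.
have [c1 c2] := fop_same q2.
have := fop_other q1; have := fop_other q2; rewrite !negbK -/v => o2 o3.
have q3 : 0 < ph i v by rewrite E2.
have [d1 d2] := fop_same q3.
split=> //; first by rewrite d2; move/eqP: Gi o1 o2 o3 E2 a1 a2 Ii; rewrite -/v; clear; lia.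
by rewrite c2 b2; move: o1 Ii; clear; lia.
Qed.

(** The dual [u] of the common target has the duals of [x] and [z] as successors. The square or
    octagon above [u] has a far corner, and its dual is the ancestor [w]. *)
Lemma fop_confl i x z : 0 < ph i x -> 0 < ph (~~ i) z -> fop i x = fop (~~ i) z ->
  (exists w, [/\ 0 < ph i w, 0 < ph (~~ i) w, ~~ (inc i w && inc (~~ i) w),
      fop (~~ i) w = x & fop i w = z]) \/
  (exists w, [/\ 0 < ph i w, 0 < ph (~~ i) w, inc i w && inc (~~ i) w,
      fop (~~ i) (fop (~~ i) (fop i w)) = x & fop i (fop i (fop (~~ i) w)) = z]).
Proof.
move=> px pz e; have [u uE] : {u | u = dual (fop i x)} by exists (dual (fop i x)).
have ux : fop i u = dual x by rewrite uE; apply: fop_dual.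
have uz : fop (~~ i) u = dual z by rewrite uE e; apply: fop_dual.
have pu : 0 < ph i u by rewrite uE ph_dual (fop_same px).2.
have pu' : 0 < ph (~~ i) u by rewrite uE ph_dual e (fop_same pz).2.
have [/andP[Ii Ij]|I] := boolP (inc i u && inc (~~ i) u); [right|left].
  have [E1 _] := fop_octagon pu pu' Ii Ij.
  have [a1 a2 a3 a4 a5] := octagon_stats pu pu' Ii Ij.
  have := @octagon_stats (~~ i) u; rewrite negbK => /(_ pu' pu Ij Ii) [b1 b2 b3 b4 b5].
  pose w := dual (fop i (fop (~~ i) (fop (~~ i) (fop i u)))).
  have wE : w = dual (fop (~~ i) (fop i (fop i (fop (~~ i) u)))) by rewrite /w E1.
  have w1 : fop i w = dual (fop (~~ i) (fop (~~ i) (fop i u))) by apply: fop_dual.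
  have w2 : fop (~~ i) w = dual (fop i (fop i (fop (~~ i) u))) by rewrite wE; apply: fop_dual.
  have W1 : ph i w = (ep i u).+1 by rewrite ph_dual.
  have W2 : ph (~~ i) w = (ep (~~ i) u).+1 by rewrite wE ph_dual.
  exists w; rewrite /inc negbK w1 w2 W1 W2 !fop_dual // ux uz !dualK !ph_dual -ux -uz a5 b5.
  by rewrite !eqxx.
have E : fop i (fop (~~ i) u) = fop (~~ i) (fop i u) by apply: fop_square.
pose w := dual (fop (~~ i) (fop i u)).
have q1 : 0 < ph (~~ i) (fop i u).
  by have := fop_other pu; move: pu'; clear; lia.
have q2 : 0 < ph i (fop (~~ i) u).
  by have := fop_other pu'; rewrite negbK; move: pu; clear; lia.
have w1 : fop (~~ i) w = x by rewrite fop_dual // ux dualK.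
have w2 : fop i w = z by rewrite /w -E fop_dual // uz dualK.
have W1 : 0 < ph i w by rewrite /w ph_dual -E (fop_same q2).2.
have W2 : 0 < ph (~~ i) w by rewrite ph_dual (fop_same q1).2.
(* The test has to be moved from [u] to [w]. If both colours passed it at [w], [inc_other] would
   make [ep] drop along the two edges into the target; dualized, both colours would pass it at
   [u]. *)
exists w; split=> //; apply/negP => /andP[Ii Ij].
have := inc_other W1 Ii; have := inc_other W2 Ij; rewrite w1 w2 negbK => n1 n2.
have xu : fop i x = dual u by rewrite uE dualK.
have zu : fop (~~ i) z = dual u by rewrite -e.
have xE : x = dual (fop i u) by rewrite ux dualK.
have zE : z = dual (fop (~~ i) u) by rewrite uz dualK.
move: n1 n2 I; rewrite /inc negbK xu zu [in ph _ x]xE [in ph _ z]zE !ph_dual.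
have := fop_other pu; have := fop_other pu'; rewrite negbK; clear; lia.
Qed.

(** * Highest weight components of simply laced crystals *)

(* Stembridge's local axioms; cr_confl also records which of cr_square and cr_octagon
   applies at w, a condition on vertices preceding y. *)
Record crystal (I T : Type) (same : rel I) (adj : I -> I -> nat) (valid : pred T)
    (E : I -> T -> T -> Prop) (eps phi : I -> T -> nat) : Prop := Crystal {
  cr_valid : forall i x y, E i x y -> valid x /\ valid y;
  cr_fun : forall i x y z, E i x y -> E i x z -> y = z;
  cr_inj : forall i x y z, E i x z -> E i y z -> x = y;
  cr_same : forall i j x y, same i j -> E i x y -> E j x y;
  cr_phi : forall i x, valid x -> 0 < phi i x -> exists y, E i x y;
  cr_eps : forall i y, valid y -> 0 < eps i y -> exists x, E i x y;
  cr_edge : forall i x y, E i x y ->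
    phi i x = (phi i y).+1 /\ eps i y = (eps i x).+1;
  cr_phi_same : forall i j x, valid x -> same i j -> phi i x = phi j x;
  cr_eps_same : forall i j x, valid x -> same i j -> eps i x = eps j x;
  cr_weight : forall i j x y, ~~ same i j -> E i x y ->
    phi j y + eps j x = phi j x + eps j y + adj i j;
  cr_square : forall i j w x z, ~~ same i j -> E i w x -> E j w z ->
    ~~ ((phi j x == (phi j w).+1) && (phi i z == (phi i w).+1)) ->
    exists2 y, E j x y & E i z y;
  cr_octagon : forall i j w x z, ~~ same i j -> E i w x -> E j w z ->
    (phi j x == (phi j w).+1) && (phi i z == (phi i w).+1) ->
    exists a b c d y, [/\ E j x a, E j a b & E i b y] /\ [/\ E i z c, E i c d & E j d y];
  cr_confl : forall i j x y z, ~~ same i j -> E i x y -> E j z y ->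
    (exists w, [/\ E j w x, E i w z &
       ~~ ((phi j z == (phi j w).+1) && (phi i x == (phi i w).+1))]) \/
    (exists w a b c d, [/\ E i w a, E j a b & E j b x] /\
       [/\ E j w c, E i c d & E i d z] /\
       (phi j a == (phi j w).+1) && (phi i c == (phi i w).+1))
}.

Section Lifting.
Variables (I T T' : Type) (same : rel I) (adj : I -> I -> nat).
Variables (valid : pred T) (E : I -> T -> T -> Prop) (eps phi : I -> T -> nat).
Variables (valid' : pred T') (E' : I -> T' -> T' -> Prop) (eps' phi' : I -> T' -> nat).
Hypothesis C : crystal same adj valid E eps phi.
Hypothesis C' : crystal same adj valid' E' eps' phi'.

(** A relation, not a map: that the partner is independent of the chosen path is exactly what has to
    be proved. The index is the length of the path. *)
Inductive parallel (x0 : T) (x0' : T') : nat -> T -> T' -> Prop :=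
| parallel0 : parallel x0 x0' 0 x0 x0'
| parallelS n i x x' y y' : parallel x0 x0' n x x' -> E i x y -> E' i x' y' ->
    parallel x0 x0' n.+1 y y'.

Variables (x0 : T) (x0' : T').
Hypotheses (v0 : valid x0) (v0' : valid' x0').
Hypotheses (hw : forall i, eps i x0 = 0) (hw' : forall i, eps' i x0' = 0).
Hypothesis wt : forall i, phi i x0 = phi' i x0'.
Local Notation M := (parallel x0 x0').

Definition same_stats n := forall x x', M n x x' ->
  forall i, phi i x = phi' i x' /\ eps i x = eps' i x'.
Definition lift_pred n := forall x x', M n x x' -> forall j w, E j w x ->
  exists m w', [/\ n = m.+1, M m w w' & E' j w' x'].

Lemma parallel_valid n x x' : M n x x' -> valid x /\ valid' x'.
Proof. by case=> // *; split; [apply: (cr_valid C _).2|apply: (cr_valid C' _).2]; eauto. Qed.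

Lemma no_pred_top j w : ~ E j w x0.
Proof. by move=> /(cr_edge C) [_]; rewrite hw. Qed.

Lemma step n x x' i y : same_stats n -> M n x x' -> E i x y ->
  exists y', E' i x' y' /\ M n.+1 y y'.
Proof.
move=> st m e; have [_ v'] := parallel_valid m.
have [p _] := st _ _ m i.
have [|y' e'] := cr_phi C' (i := i) v'; first by rewrite -p (cr_edge C e).1.
by exists y'; split=> //; apply: parallelS e e'.
Qed.

(** Confluence at [y] gives a common ancestor of [x] and [z]. It is lifted downwards from [x] by
    hypothesis, the path up to [z] is copied on the other side, and the square or octagon there ends
    at [y']. Equal statistics at lower ranks guarantee that the same shape applies. *)
Lemma lift_predS n : (forall m, m <= n -> same_stats m) ->
  (forall m, m <= n -> lift_pred m) -> lift_pred n.+1.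
Proof.
move=> st lp y y' H; inversion H as [|k i x x' ? ? Mx e e']; subst => j z ez.
(* For equal colours the predecessor is unique, so it is [x] itself. *)
have [s|ns] := boolP (same i j).
  have ez' := cr_same C s e; rewrite (cr_inj C ez ez').
  by exists n, x'; split=> //; apply: cr_same C' _ _ _ _ s e'.
case: (cr_confl C ns e ez) => [[w [ewx ewz ninc]]|[w [a [b [c [d [[e1 e2 e3] [[e4 e5 e6] inc]]]]]]]].
- have [m [w' [En Mw ewx']]] := lp _ (leqnn n) _ _ Mx _ _ ewx; subst n.
  have [z' [ewz' Mz]] := step (st _ (leqnSn m)) Mw ewz.
  have sx := (st _ (leqnn _) _ _ Mx); have sz := (st _ (leqnn _) _ _ Mz).
  have sw := (st _ (leqnSn m) _ _ Mw).
  have [|u ezu exu] := cr_square C' ns ewz' ewx'.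
    by rewrite -(sz j).1 -(sw j).1 -(sw i).1 -(sx i).1.
  by exists m.+1, z'; split=> //; rewrite -(cr_fun C' exu e').
- have [n1 [b' [En Mb e3']]] := lp _ (leqnn n) _ _ Mx _ _ e3; subst n.
  have [n2 [a' [En Ma e2']]] := lp _ (leqnSn _) _ _ Mb _ _ e2; subst n1.
  have [|n3 [w' [En Mw e1']]] := lp n2 _ _ _ Ma _ _ e1; first lia.
  subst n2.
  have [|c' [e4' Mc]] := step (st n3 _) Mw e4; first lia.
  have [|d' [e5' Md]] := step (st n3.+1 _) Mc e5; first lia.
  have [|z' [e6' Mz]] := step (st n3.+2 _) Md e6; first lia.
  have sw : same_stats n3 by apply: st; lia.
  have sv : same_stats n3.+1 by apply: st; lia.
  have [|p1 [p2 [p3 [p4 [u]]]]] := cr_octagon C' ns e1' e4'.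
    by rewrite -(sv _ _ Ma j).1 -(sw _ _ Mw j).1 -(sw _ _ Mw i).1 -(sv _ _ Mc i).1.
  case=> [[q1 q2 q3] [q4 q5 q6]].
  exists n3.+3, z'; split=> //.
  (* Edges of one colour leaving a vertex are unique, so the octagon just obtained runs through the
     vertices already found and ends at [y']. *)
  have ? := cr_fun C' q1 e2'; subst p1.
  have ? := cr_fun C' q2 e3'; subst p2.
  have ? := cr_fun C' q3 e'; subst u.
  have ? := cr_fun C' q4 e5'; subst p3.
  by have ? := cr_fun C' q5 e6'; subst p4.
Qed.

End Lifting.

Lemma parallel_sym (I T T' : Type) (E : I -> T -> T -> Prop) (E' : I -> T' -> T' -> Prop)
  x0 x0' n x x' : parallel E E' x0 x0' n x x' -> parallel E' E x0' x0 n x' x.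
Proof. by elim=> [|m i y y' z z' _ IH e e']; [apply: parallel0|apply: parallelS IH e' e]. Qed.

Section Matching.
Variables (I T T' : Type) (same : rel I) (adj : I -> I -> nat).
Variables (valid : pred T) (E : I -> T -> T -> Prop) (eps phi : I -> T -> nat).
Variables (valid' : pred T') (E' : I -> T' -> T' -> Prop) (eps' phi' : I -> T' -> nat).
Hypothesis C : crystal same adj valid E eps phi.
Hypothesis C' : crystal same adj valid' E' eps' phi'.
Variables (x0 : T) (x0' : T').
Hypotheses (v0 : valid x0) (v0' : valid' x0').
Hypotheses (hw : forall i, eps i x0 = 0) (hw' : forall i, eps' i x0' = 0).
Hypothesis wt : forall i, phi i x0 = phi' i x0'.
Local Notation M := (parallel E E' x0 x0').
Local Notation M' := (parallel E' E x0' x0).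

(** The order inside one rank avoids circularity: lifting of predecessors uses statistics of lower
    ranks only; a positive [eps] means a predecessor, so lifting gives equality of [eps]; the weight
    axiom then gives equality of [phi]. *)
Lemma parallel_main n :
  same_stats E eps phi E' eps' phi' x0 x0' n /\
  (lift_pred E E' x0 x0' n /\ lift_pred E' E x0' x0 n).
Proof.
have [k lt_nk] := ubnP n; elim: k n lt_nk => // k IH [|n] lt_nk.
  split=> [x x' H i|]; first by inversion H; subst; rewrite wt hw hw'.
  split=> x x' H j w e; inversion H; subst.
    by have := no_pred_top C hw e.
  by have := no_pred_top C' hw' e.
have st m : m <= n -> same_stats E eps phi E' eps' phi' x0 x0' m.
  by move=> le; have [|] := IH m => //; lia.
have st' m : m <= n -> same_stats E' eps' phi' E eps phi x0' x0 m.
  by move=> le x x' H i; have [-> ->] := st m le _ _ (parallel_sym H) i.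
have lp : lift_pred E E' x0 x0' n.+1.
  by apply: (lift_predS C C' v0 v0' st) => m le; have [|_ []] := IH m => //; lia.
have lp' : lift_pred E' E x0' x0 n.+1.
  by apply: (lift_predS C' C v0' v0 st') => m le; have [|_ []] := IH m => //; lia.
split=> // y y' H j; have [vy vy'] := parallel_valid C C' v0 v0' H.
have se : eps j y = eps' j y'.
  case: (posnP (eps j y)) => [e0|/(cr_eps C vy) [z ez]].
    case: (posnP (eps' j y')) => [->//|/(cr_eps C' vy') [z' ez']].
    have [m [z [_ _ ez]]] := lp' _ _ (parallel_sym H) _ _ ez'.
    by move: e0; rewrite (cr_edge C ez).2.
  have [m [z' [[<-] Mz ez']]] := lp _ _ H _ _ ez.
  by rewrite (cr_edge C ez).2 (cr_edge C' ez').2 (st n (leqnn n) _ _ Mz j).2.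
split=> //.
move: lp lp' => _ _; inversion H as [|m i x x' ? ? Mx e e']; subst.
have [px ex] := st n (leqnn n) _ _ Mx j.
have [s|ns] := boolP (same i j).
  have [p1 _] := cr_edge C (cr_same C s e); have [p2 _] := cr_edge C' (cr_same C' s e').
  by move: px; rewrite p1 p2 => -[].
have := cr_weight C ns e; have := cr_weight C' ns e'; lia.
Qed.

Lemma parallel_inj m n x x1 x2 : M m x x1 -> M n x x2 -> m = n /\ x1 = x2.
Proof.
move=> H; elim: H n x2 => {m x x1} [|m i x x' y y' Mx IH e e'] n x2 H.
  by inversion H; subst => //; have := no_pred_top C hw H1.
have [k [w' [-> Mw ew]]] := (parallel_main n).2.1 _ _ H _ _ e.
have [-> ?] := IH _ _ Mw; subst w'; split=> //.
exact: (cr_fun C' e' ew).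
Qed.

End Matching.

(** * Good nodes as uncancelled letters *)

Lemma nA0_good T (A R : T -> bool) w : nA A R w = 0 -> good A R w = None.
Proof.
elim: w => //= x w IH; case: (A x) => //=; rewrite add0n => /eqP.
by rewrite subn_eq0 => le; rewrite ltnNge le.
Qed.

Lemma good_nA0 T (A R : T -> bool) w : good A R w = None -> nA A R w = 0.
Proof.
elim: w => //= x w IH; case: ltnP => [lt /IH E|le]; first by rewrite E in lt.
by case: (A x) => // _; rewrite add0n; apply/eqP; rewrite subn_eq0.
Qed.

Definition is_rem (x : node) := ~~ is_add x.

Definition lastadd (w : seq node) : option node :=
  if [seq x <- w | is_add x] is x :: s then Some (last x (x :: s)) else None.

Lemma cancelRA_cons x y w : cancelRA [:: x, y & w] =
  if ~~ is_add x && is_add y then w else x :: cancelRA (y :: w).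
Proof. by []. Qed.

Lemma cancelRA_nA w : nA is_add is_rem (cancelRA w) = nA is_add is_rem w /\
  good is_add is_rem (cancelRA w) = good is_add is_rem w.
Proof.
have consE x u v : nA is_add is_rem u = nA is_add is_rem v /\
    good is_add is_rem u = good is_add is_rem v ->
    nA is_add is_rem (x :: u) = nA is_add is_rem (x :: v) /\
    good is_add is_rem (x :: u) = good is_add is_rem (x :: v).
  by move=> [E1 E2]; rewrite /= E1 E2.
elim: w => // x [|y w] IH //.
rewrite cancelRA_cons; case: ifP => [/andP[rx ay]|_]; last exact: consE IH.
rewrite /= /is_rem rx (negbTE rx) ay /= !subn0 add0n addKn; split=> //.
case: (posnP (nA is_add (fun x => ~~ is_add x) w)) => [n0|n1].
  by rewrite n0 /= nA0_good.
by rewrite ltnS n1.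
Qed.

Lemma cancelRA_size w : cancelRA w = w \/ size w = (size (cancelRA w)).+2.
Proof.
elim: w => [|x [|y w] IH]; [by left|by left|].
rewrite cancelRA_cons; case: ifP => _; first by right.
case: IH => [->|E]; first by left.
by right; rewrite [LHS]/= -/(size (y :: w)) E.
Qed.

Lemma reduce_wordK w : cancelRA (reduce_word w) = reduce_word w.
Proof.
rewrite /reduce_word.
(* A pass that changes the word shortens it by two, so as many passes as letters are enough. *)
have: size w <= size w by []. move: {2 3 4}(size w) => n; elim: n w => [|n IH] w.
  by case: w.
rewrite iterSr => h; case: (cancelRA_size w) => [E|E].
  by rewrite E; elim: n {IH h} => [|n IHn]; rewrite /= ?IHn.
by apply: IH; move: h; rewrite E => /ltnW.
Qed.

Lemma cancelRA_head_fixed x w : cancelRA (x :: w) = x :: w ->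
  cancelRA w = w /\ (is_rem x -> all is_rem w).
Proof.
elim: w x => // y w IH x; rewrite cancelRA_cons; case: ifP => [_ E|].
  by have := congr1 size E => /=; lia.
move=> h [E]; have [_ r] := IH y E; split=> // rx; rewrite /is_rem in rx *.
by move: h; rewrite rx /= => ay; rewrite /= /is_rem ay r // /is_rem ay.
Qed.

(** A word fixed by [cancelRA] has no factor RA, hence no A after an R, and all its A's survive. *)
Lemma good_fixed w : cancelRA w = w ->
  nA is_add is_rem w = count is_add w /\ good is_add is_rem w = lastadd w.
Proof.
elim: w => // x w IH E; have [E' r] := cancelRA_head_fixed E.
have [n g] := IH E'; rewrite /= /lastadd /= n g /is_rem.
case ax: (is_add x) => /=.
  rewrite subn0; split=> //; rewrite /lastadd -size_filter.
  by case: [seq x <- w | is_add x].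
have := r (negbT ax); rewrite (eq_all (a2 := predC is_add)) // all_predC has_count -eqn0Ngt.
move=> /eqP c0; rewrite c0; move: c0; rewrite -size_filter => /size0nil ->; by [].
Qed.

Lemma good_nodeE d e i nu : good_node d e i nu = good is_add is_rem (iword d e i nu).
Proof.
rewrite /good_node; have [_ g] := good_fixed (reduce_wordK (iword d e i nu)).
have <- : good is_add is_rem (reduce_word (iword d e i nu)) = good is_add is_rem (iword d e i nu).
  rewrite /reduce_word; elim: (size _) => //= n <-; exact: (cancelRA_nA _).2.
by rewrite g /lastadd; case: filter.
Qed.

(** Letters that are neither A nor R are neutral. This allows [iword], whose positions depend on the
    bipartition, to be replaced by a list of sites that does not. *)
Lemma nA_filter T (A R : T -> bool) w :
  nA A R [seq x <- w | A x || R x] = nA A R w /\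
  good A R [seq x <- w | A x || R x] = good A R w.
Proof.
elim: w => //= x w [IH1 IH2]; case: ifP => /=; first by rewrite IH1 IH2.
move=> /norP[/negbTE-> /negbTE->]; rewrite add0n subn0 IH1 IH2; split=> //.
by case: posnP => // /nA0_good ->.
Qed.

Lemma nR_filter T (A R : T -> bool) w :
  nR A R [seq x <- w | A x || R x] = nR A R w.
Proof.
rewrite -!nA_rev -filter_rev; under eq_filter => x do rewrite orbC.
exact: (nA_filter _ _ _).1.
Qed.

Lemma eq_in_nA T (A R A' R' : T -> bool) w :
  all (fun x => (A x == A' x) && (R x == R' x)) w ->
  nA A R w = nA A' R' w /\ good A R w = good A' R' w.
Proof.
elim: w => //= x w IH /andP[/andP[/eqP-> /eqP->] /IH[-> ->]]; by [].
Qed.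

Lemma eq_in_nR T (A R A' R' : T -> bool) w :
  all (fun x => (A x == A' x) && (R x == R' x)) w -> nR A R w = nR A' R' w.
Proof.
move=> h; rewrite -!nA_rev; apply: (eq_in_nA _).1; rewrite all_rev.
by rewrite (eq_all (a2 := fun x => (A x == A' x) && (R x == R' x))) // => x; rewrite andbC.
Qed.

Lemma good_map T T' (A R : T -> bool) (g : T' -> T) w :
  good A R (map g w) = omap g (good (A \o g) (R \o g) w).
Proof.
elim: w => //= x w ->; rewrite nA_map; case: ifP => //; by case: ifP.
Qed.

(** * Beads of charged partitions *)

Local Open Scope ring_scope.

(* Row a puts a bead at the content of its first empty box, so a node of content c is
   addable iff c carries a bead and c + 1 does not, removable iff the converse holds. *)
Definition bpos (c : int) (la : seq nat) (a : nat) : int := (nth 0%N la a)%:Z - a%:Z + c.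

Definition bead (c : int) (la : seq nat) (p : int) : bool :=
  (p <= c - (size la)%:Z) || (p \in [seq bpos c la a | a <- iota 0 (size la)]).

Lemma beadP c la p : reflect (exists a, p = bpos c la a) (bead c la p).
Proof.
apply: (iffP orP) => [[h|/mapP[a _ ->]]|[a ->]]; last 2 first.
- by exists a.
- have [lt|ge] := ltnP a (size la); [right|left].
    by apply: map_f; rewrite mem_iota.
  by rewrite /bpos nth_default //; lia.
exists `|c - p|%N; rewrite /bpos nth_default; lia.
Qed.

Lemma nth_partition la a : is_partition la -> (nth 0 la a.+1 <= nth 0 la a)%N.
Proof.
case/andP=> /(sortedP 0%N) s _; have [/s//|ge] := ltnP a.+1 (size la).
by rewrite nth_default.
Qed.

Lemma nth_partition_le la a b : is_partition la -> (a <= b)%N ->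
  (nth 0 la b <= nth 0 la a)%N.
Proof.
move=> P; elim: b => [|b IH]; first by rewrite leqn0 => /eqP->.
rewrite leq_eqVlt => /orP[/eqP->//|lt].
exact: leq_trans (nth_partition b P) (IH lt).
Qed.

Lemma nth_partition_gt0 la a : is_partition la -> (0 < nth 0 la a)%N = (a < size la)%N.
Proof.
case/andP=> _ /allP P; have [lt|ge] := ltnP a (size la); first by rewrite P ?mem_nth.
by rewrite nth_default.
Qed.

Lemma partition_eq la mu : is_partition la -> is_partition mu ->
  (forall a, nth 0%N la a = nth 0%N mu a) -> la = mu.
Proof.
move=> Pl Pm E; apply: (@eq_from_nth _ 0%N) => [|a _]; last exact: E.
apply/eqP; rewrite eqn_leq; apply/andP; split; rewrite leqNgt;
  [rewrite -(nth_partition_gt0 _ Pl) E | rewrite -(nth_partition_gt0 _ Pm) -E];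
  by rewrite nth_default.
Qed.

Lemma bpos_lt c la a b : is_partition la -> (a < b)%N -> bpos c la b < bpos c la a.
Proof. by move=> P lt; have := nth_partition_le P (ltnW lt); rewrite /bpos; lia. Qed.

Lemma bpos_inj c la : is_partition la -> injective (bpos c la).
Proof.
move=> P a b E; case: (ltngtP a b) => // /(bpos_lt c P); rewrite E; lia.
Qed.

(** Both row enumerations are strictly decreasing with the same image; given agreement on earlier
    rows, each value bounds the other. *)
Lemma bead_bpos c c' la mu : is_partition la -> is_partition mu ->
  bead c la =1 bead c' mu -> forall a, bpos c la a = bpos c' mu a.
Proof.
have half k k' la' mu' : is_partition la' -> is_partition mu' -> bead k la' =1 bead k' mu' ->
  forall a, (forall b, (b < a)%N -> bpos k la' b = bpos k' mu' b) ->
  bpos k la' a <= bpos k' mu' a.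
  move=> Pl Pm E a IH; have : bead k' mu' (bpos k la' a) by rewrite -E; apply/beadP; exists a.
  case/beadP=> b Eb; rewrite Eb; case: (ltngtP b a) => [lt|lt|->//].
    by move: (lt); rewrite -(bpos_inj Pl (etrans Eb (esym (IH _ lt)))) ltnn.
  exact: ltW (bpos_lt _ Pm lt).
move=> Pl Pm E a; elim/ltn_ind: a => a IH; apply/eqP; rewrite eq_le half //=.
by apply: half => // b lt; rewrite IH.
Qed.

Lemma bead_charge_inj c c' la mu : is_partition la -> is_partition mu ->
  bead c la =1 bead c' mu -> c = c' /\ la = mu.
Proof.
move=> Pl Pm /(bead_bpos Pl Pm) E.
have cc : c = c'.
  (* In a row below both partitions the bead position depends on the charge only. *)
  have := E (size la + size mu)%N; rewrite /bpos !nth_default ?leq_addr ?leq_addl //; lia.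
split=> //; apply: partition_eq => // a; have := E a; rewrite /bpos cc; lia.
Qed.

Definition cfg (d : int * int) (nu : bipart) (j : nat) : int -> bool :=
  bead (dcomp d j) (part_comp nu j).

Definition same_cfg (X Y : nat -> int -> bool) := forall j p, (j < 2)%N -> X j p = Y j p.

Lemma cfg_inj d nu nu' : is_bipartition nu -> is_bipartition nu' ->
  same_cfg (cfg d nu) (cfg d nu') -> nu = nu'.
Proof.
case: nu nu' => [la mu] [la' mu'] /andP[/= p q] /andP[/= p' q'] E.
by congr pair; [apply: (@bead_charge_inj d.1 d.1 _ _ _ _ _).2 | apply: (@bead_charge_inj d.2 d.2 _ _ _ _ _).2]
  => // x; [apply: (E 0%N) | apply: (E 1%N)].
Qed.

Definition site := (int * nat)%type.

Definition site_le (s t : site) : bool :=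
  (s.1 < t.1) || ((s.1 == t.1) && (t.2 <= s.2)%N).

Lemma site_le_trans : transitive site_le.
Proof. by move=> [a i] [b j] [c k]; rewrite /site_le /=; lia. Qed.
Lemma site_le_total : total site_le.
Proof. by move=> [a i] [b j]; rewrite /site_le /=; lia. Qed.
Lemma site_le_anti : antisymmetric site_le.
Proof.
move=> [a i] [b j]; rewrite /site_le /= => h.
have [-> ->//] : a = b /\ i = j by lia.
Qed.

Definition sA (X : nat -> int -> bool) (s : site) := X s.2 s.1 && ~~ X s.2 (s.1 + 1).
Definition sR (X : nat -> int -> bool) (s : site) := ~~ X s.2 s.1 && X s.2 (s.1 + 1).

(** One index list for all vertices, so that an edge changes letters but not positions. [site_le]
    breaks ties like [node_le], the larger component first. *)
Definition sites (e : nat) (i : int) (K : nat) : seq site :=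
  sort site_le [seq (e%:Z * (m%:Z - K%:Z) + i, j) | m <- iota 0 K.*2, j <- [:: 0%N; 1%N]].

Lemma sites_uniq e i K : (0 < e)%N -> uniq (sites e i K).
Proof.
move=> e0; rewrite sort_uniq allpairs_uniq ?iota_uniq // => -[m j] [m' j'] _ _ [h ->].
by congr pair; nia.
Qed.

Lemma mem_sites e i K s : (s \in sites e i K) =
  (s.2 < 2)%N && (s.1 \in [seq e%:Z * (m%:Z - K%:Z) + i | m <- iota 0 K.*2]).
Proof.
rewrite mem_sort; apply/allpairsP/andP => [[[m j] [/= hm hj ->]]|[h /mapP[m hm E]]] /=.
  by split; [move: hj; rewrite !inE => /orP[] /eqP-> | apply: map_f].
by exists (m, s.2); split=> //=; [case: (s.2) h => [|[]] | case: s E h => ? ? /= ->].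
Qed.

Lemma sites_shift e i K (k : int) : sites e (i + k) K = [seq (s.1 + k, s.2) | s <- sites e i K].
Proof.
rewrite /sites [RHS](map_sort (leT := site_le)) => [|x y]; last by rewrite /site_le /=; lia.
congr sort; rewrite map_allpairs; apply: eq_allpairs => m j /=.
by rewrite addrA.
Qed.

Definition site_of (x : node) : site := (cont x, comp x).

Lemma addable_sites d j la : is_partition la ->
  [/\ uniq [seq site_of x | x <- addable_nodes d j la],
   all (fun x => is_add x && (comp x == j)) (addable_nodes d j la) &
   forall s, (s \in [seq site_of x | x <- addable_nodes d j la]) =
     [&& s.2 == j, bead (dcomp d j) la s.1 & ~~ bead (dcomp d j) la (s.1 + 1)]].
Proof.
move=> P; rewrite /addable_nodes -map_comp; split.
- rewrite map_inj_uniq ?filter_uniq ?iota_uniq // => a b [].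
  by rewrite /content => h; apply: (bpos_inj P (c := dcomp d j)).
- by rewrite all_map; apply/allP => a _ /=; rewrite eqxx.
have [S memS] : {S | S = iota 0 (size la).+1} by eexists.
rewrite -memS; move=> [p j']; apply/mapP/idP => /= [[a]|/and3P[/eqP-> /beadP[a ->] nb]].
  rewrite mem_filter memS mem_iota => /andP[h _] [-> ->]; rewrite /= eqxx /=.
  have -> : content d j a (nth 0%N la a) = bpos (dcomp d j) la a by [].
  apply/andP; split; first by apply/beadP; exists a.
  apply/negP => /beadP[b E].
  case: a h E => [|a] /= h E.
    by have := nth_partition_le P (leq0n b); move: E; rewrite /bpos; lia.
  have [lt|ge] := ltnP a b.
    have := nth_partition_le P lt; move: E; rewrite /bpos; lia.
  have := nth_partition_le P ge; move: E; rewrite /bpos; lia.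
exists a; [|by []]; rewrite mem_filter memS mem_iota; apply/andP; split.
  case: a nb => // a; rewrite /= ltn_neqAle nth_partition // andbT.
  apply: contra => /eqP E; apply/beadP; exists a; rewrite /bpos E; lia.
rewrite ltnNge; apply/negP => lt; case/negP: nb; apply/beadP; exists a.-1.
rewrite /bpos !nth_default; lia.
Qed.

Lemma removable_sites d j la : is_partition la ->
  [/\ uniq [seq site_of x | x <- removable_nodes d j la],
   all (fun x => ~~ is_add x && (comp x == j)) (removable_nodes d j la) &
   forall s, (s \in [seq site_of x | x <- removable_nodes d j la]) =
     [&& s.2 == j, ~~ bead (dcomp d j) la s.1 & bead (dcomp d j) la (s.1 + 1)]].
Proof.
move=> P; rewrite /removable_nodes -map_comp.
have cE a : (nth 0 la a.+1 < nth 0 la a)%N ->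
    content d j a (nth 0%N la a).-1 = bpos (dcomp d j) la a - 1.
  by rewrite /content /bpos; lia.
split.
- rewrite map_inj_in_uniq ?filter_uniq ?iota_uniq // => a b.
  rewrite !mem_filter => /andP[ha _] /andP[hb _] [].
  rewrite !cE // => h; apply: (bpos_inj P (c := dcomp d j)); lia.
- by rewrite all_map; apply/allP => a _ /=; rewrite eqxx.
have [S memS] : {S | S = iota 0 (size la)} by eexists.
rewrite -memS; move=> [p j']; apply/mapP/idP => /= [[a]|/and3P[/eqP-> nb /beadP[a E]]].
  rewrite mem_filter memS mem_iota => /andP[h _] [-> ->]; rewrite /= eqxx /= cE //.
  rewrite subrK andbC; apply/andP; split; first by apply/beadP; exists a.
  apply/negP => /beadP[b E].
  have [lt|ge] := ltnP a b.
    have := nth_partition_le P lt; move: E h; rewrite /bpos; lia.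
  have := nth_partition_le P ge; move: E h; rewrite /bpos; lia.
have h : (nth 0 la a.+1 < nth 0 la a)%N.
  rewrite ltn_neqAle nth_partition // andbT.
  apply: contra nb => /eqP E'; apply/beadP; exists a.+1; move: E; rewrite /bpos E'; lia.
exists a; last by rewrite /site_of /= cE // -E addrK.
rewrite mem_filter memS mem_iota h /= -(nth_partition_gt0 _ P); lia.
Qed.

(** * Crystal edges as bead moves *)

Definition phi d e i nu := nA is_add is_rem (iword d e i nu).
Definition eps d e i nu := nR is_add is_rem (iword d e i nu).

Definition wide (K : nat) (i : int) (X : nat -> int -> bool) := forall j p, (j < 2)%N ->
  (p <= i - K%:Z -> X j p) /\ (i + K%:Z <= p -> ~~ X j p).

Lemma mem_sitesP (e : nat) (i : int) K (s : site) : reflect ((s.2 < 2)%N /\ exists q : int,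
   [/\ - K%:Z <= q, q < K%:Z & s.1 = e%:Z * q + i]) (s \in sites e i K).
Proof.
rewrite mem_sites; apply: (iffP andP) => -[h].
  case/mapP=> m; rewrite mem_iota => hm E; split=> //.
  by exists (m%:Z - K%:Z); split=> //; lia.
case=> q [q1 q2 E]; split=> //; apply/mapP; exists `|(q + K%:Z)%R|%N.
  by rewrite mem_iota; lia.
by rewrite E; congr (_ * _ + _); lia.
Qed.

Lemma modz_eq0P (e : nat) (c i : int) :
  reflect (exists q : int, c = e%:Z * q + i) (((c - i) %% e%:Z)%Z == 0).
Proof.
apply: (iffP eqP) => [/dvdz_mod0P h|[q ->]]; first by case/dvdzP: h => q E; exists q; lia.
by rewrite addrK mulrC modzMl.
Qed.

Lemma wide_in_sites (e : nat) i K X (s : site) : (0 < e)%N -> wide K i X -> (s.2 < 2)%N ->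
  ((s.1 - i) %% e%:Z)%Z == 0 -> sA X s || sR X s -> s \in sites e i K.
Proof.
move=> e0 w s2 /modz_eq0P[q E] h; apply/mem_sitesP; split=> //; exists q.
have [w1 w2] := w s.2 s.1 s2; have [w3 w4] := w s.2 (s.1 + 1) s2.
suff: - K%:Z <= q /\ q < K%:Z by case.
move: h; rewrite /sA /sR => h; split.
  rewrite leNgt; apply/negP => lt; have [u v]: s.1 <= i - K%:Z /\ s.1 + 1 <= i - K%:Z by nia.
  by rewrite w1 ?w3 in h.
rewrite ltNge; apply/negP => lt; have [u v]: i + K%:Z <= s.1 /\ i + K%:Z <= s.1 + 1 by nia.
by rewrite (negbTE (w2 _)) ?(negbTE (w4 _)) in h.
Qed.

Definition node_ok d nu (x : node) :=
  [&& (comp x < 2)%N, is_add x == sA (cfg d nu) (site_of x), is_rem x == sR (cfg d nu) (site_of x) &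
   is_add x ==> let la := part_comp nu (comp x) in
    [&& (row x == 0%N) || (nth 0 la (row x) < nth 0 la (row x).-1)%N,
        (row x <= size la)%N & cont x == bpos (dcomp d (comp x)) la (row x)]].

Lemma addable_ok d nu j : (j < 2)%N -> is_partition (part_comp nu j) ->
  all (node_ok d nu) (addable_nodes d j (part_comp nu j)).
Proof.
move=> j2 P; have [_ _ m] := addable_sites d j P.
have {}m s : s \in [seq site_of x | x <- addable_nodes d j (part_comp nu j)] ->
    s.2 = j /\ sA (cfg d nu) s by rewrite m /sA /cfg => /and3P[/eqP-> -> ->].
move: m; rewrite /addable_nodes -map_comp all_map => m.
apply/allP => a ha; have /= [_ A] := m _ (map_f _ ha).
have R : sR (cfg d nu) (content d j a (nth 0%N (part_comp nu j) a), j) = false.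
  by move: A; rewrite /sA /sR /= => /andP[-> _].
rewrite /= /node_ok /= j2 /is_rem /site_of /= A R eqxx /=.
move: ha; rewrite mem_filter mem_iota => /andP[-> h] /=.
by rewrite eqxx andbT; lia.
Qed.

Lemma removable_ok d nu j : (j < 2)%N -> is_partition (part_comp nu j) ->
  all (node_ok d nu) (removable_nodes d j (part_comp nu j)).
Proof.
move=> j2 P; have [_ _ m] := removable_sites d j P.
have {}m s : s \in [seq site_of x | x <- removable_nodes d j (part_comp nu j)] ->
    s.2 = j /\ sR (cfg d nu) s by rewrite m /sR /cfg => /and3P[/eqP-> -> ->].
move: m; rewrite /removable_nodes -map_comp all_map => m.
apply/allP => a ha; have /= [_ R] := m _ (map_f _ ha).
have A : sA (cfg d nu) (content d j a (nth 0%N (part_comp nu j) a).-1, j) = false.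
  by move: R; rewrite /sA /sR /= => /andP[/negbTE-> _].
by rewrite /= /node_ok /= j2 /is_rem /site_of /= A R.
Qed.

(** Each site carries at most one node and [site_le] is a total order, so both sorted lists agree
    once they contain the same sites. *)
Lemma iword_sites d (e : nat) i nu K : (0 < e)%N -> is_bipartition nu ->
  wide K i (cfg d nu) ->
  all (node_ok d nu) (iword d e i nu) /\
  [seq site_of x | x <- iword d e i nu] =
    [seq s <- sites e i K | sA (cfg d nu) s || sR (cfg d nu) s].
Proof.
move=> e0 /andP[P1 P2] w; rewrite /iword; split.
  have P : all (node_ok d nu) (addable_nodes d 0 nu.1 ++ removable_nodes d 0 nu.1
     ++ addable_nodes d 1 nu.2 ++ removable_nodes d 1 nu.2).
    rewrite !all_cat; apply/and4P; split.
    - exact: (@addable_ok d nu 0 isT P1).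
    - exact: (@removable_ok d nu 0 isT P1).
    - exact: (@addable_ok d nu 1 isT P2).
    - exact: (@removable_ok d nu 1 isT P2).
  by rewrite all_sort all_filter; apply: sub_all P => x /= ->; rewrite implybT.
have [a1 _ a3] := addable_sites d 0 P1; have [b1 _ b3] := removable_sites d 0 P1.
have [c1 _ c3] := addable_sites d 1 P2; have [d1 _ d3] := removable_sites d 1 P2.
rewrite (map_sort (leT := site_le)) //.
rewrite /sites (filter_sort site_le_total site_le_trans).
apply/(perm_sortP site_le_total site_le_trans site_le_anti).
have -> : [seq x <- addable_nodes d 0 nu.1 ++ removable_nodes d 0 nu.1
     ++ addable_nodes d 1 nu.2 ++ removable_nodes d 1 nu.2 | has_res e i x] =
   [seq x <- addable_nodes d 0 nu.1 ++ removable_nodes d 0 nu.1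
     ++ addable_nodes d 1 nu.2 ++ removable_nodes d 1 nu.2 |
     (((site_of x).1 - i) %% e%:Z)%Z == 0] by [].
rewrite -(filter_map site_of (fun s : site => ((s.1 - i) %% e%:Z)%Z == 0)) !map_cat.
have u := sites_uniq i K e0; rewrite sort_uniq in u.
have dis (j : nat) s : ~~ ([&& s.2 == j, bead (dcomp d j) (part_comp nu j) s.1 & ~~ bead (dcomp d j) (part_comp nu j) (s.1 + 1)]
  && [&& s.2 == j, ~~ bead (dcomp d j) (part_comp nu j) s.1 & bead (dcomp d j) (part_comp nu j) (s.1 + 1)]).
  by case: (bead _ _ s.1); rewrite !(andbF, andbT).
apply: uniq_perm; rewrite ?filter_uniq //.
  rewrite !cat_uniq a1 b1 c1 d1 !andTb !andbT; apply/and3P; split; apply/hasPn => s.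
  - rewrite !mem_cat a3 b3 c3 d3 => /orP[h|/orP[]/and3P[/eqP-> _ _]]; rewrite ?eqxx //.
    by apply: contra (dis 0%N s) => ->.
  - by rewrite !mem_cat b3 c3 d3 => /orP[]/and3P[/eqP-> _ _].
  - by rewrite c3 d3 => h; apply: contra (dis 1%N s) => ->.
move=> s; rewrite !mem_filter.
have -> : (s \in [seq (e%:Z * (m%:Z - K%:Z) + i, j) | m <- iota 0 K.*2, j <- [:: 0%N; 1%N]])
  = (s \in sites e i K) by rewrite mem_sort.
rewrite !mem_cat a3 b3 c3 d3; apply/andP/andP => [[r h]|[h m]].
  have h2 : (s.2 < 2)%N by case/or4P: h => /and3P[/eqP-> _ _].
  have hh : sA (cfg d nu) s || sR (cfg d nu) s.
    rewrite /sA /sR /cfg; case/or4P: h => /and3P[/eqP-> h1 h3];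
    by rewrite /part_comp /= ?h1 ?h3 ?(negbTE h1) ?(negbTE h3) ?orbT.
  by split=> //; apply: wide_in_sites hh.
have [h2 [q [_ _ E]]] := mem_sitesP _ _ _ _ m; split.
  by apply/modz_eq0P; exists q.
move: h; rewrite /sA /sR /cfg; case: s h2 {m E} => p [|[|]] //= _ => /orP[] ->; rewrite /= ?orbT //.
Qed.

Lemma phi_epsE d (e : nat) i nu K : (0 < e)%N -> is_bipartition nu ->
  wide K i (cfg d nu) -> let X := cfg d nu in
  [/\ phi d e i nu = nA (sA X) (sR X) (sites e i K),
      eps d e i nu = nR (sA X) (sR X) (sites e i K) &
      omap site_of (good_node d e i nu) = good (sA X) (sR X) (sites e i K)].
Proof.
move=> e0 P w X; have [ok E] := iword_sites e0 P w.
have ok' : all (fun x => (is_add x == (sA X \o site_of) x) && (is_rem x == (sR X \o site_of) x))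
    (iword d e i nu).
  by apply: sub_all ok => x /and4P[_ /eqP-> /eqP-> _]; rewrite !eqxx.
have [n g] := eq_in_nA ok'.
rewrite /phi /eps good_nodeE n g (eq_in_nR ok') -good_map -nA_map -nR_map E nR_filter.
by have [-> ->] := nA_filter (sA X) (sR X) (sites e i K).
Qed.

Lemma partition_of_fun (f : nat -> nat) n : (forall a, (f a.+1 <= f a)%N) -> f n = 0%N ->
  exists2 la, is_partition la & forall a, nth 0%N la a = f a.
Proof.
move=> anti fn; have ex : exists n, f n == 0%N by exists n; rewrite fn.
case: (ex_minnP ex) => m /eqP fm min.
have f0 a : (m <= a)%N -> f a = 0%N.
  elim: a => [|a IH]; first by rewrite leqn0 => /eqP m0; move: fm; rewrite m0.
  rewrite leq_eqVlt => /orP[/eqP<-//|/IH E]; have := anti a; rewrite E; lia.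
exists (mkseq f m) => [|a]; last first.
  by have [lt|ge] := ltnP a m; [rewrite nth_mkseq | rewrite nth_default ?size_mkseq // f0].
apply/andP; split.
  apply/(sortedP 0%N) => a; rewrite size_mkseq => lt; rewrite !nth_mkseq //; last exact: ltnW.
  exact: anti.
apply/allP => x /mapP[a]; rewrite mem_iota => /andP[_ lt] ->; rewrite lt0n.
by apply/negP => /min; rewrite leqNgt lt.
Qed.

Lemma bead_incr c la la' a : is_partition la -> is_partition la' ->
  (forall b, nth 0%N la' b = ((a == b) + nth 0%N la b)%N) ->
  forall p, bead c la' p = if p == bpos c la a then false
    else if p == bpos c la a + 1 then true else bead c la p.
Proof.
move=> P P' E p.
have bE b : bpos c la' b = bpos c la b + (a == b)%:Z by rewrite /bpos E; lia.
case: eqP => [->|n1].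
  apply/negP => /beadP[b]; have [<-|ne] := eqVneq a b; first by rewrite bE eqxx; lia.
  by rewrite bE (negbTE ne) addr0 => /(bpos_inj P) e; rewrite e eqxx in ne.
case: eqP => [->|n2]; first by apply/beadP; exists a; rewrite bE eqxx.
apply/beadP/beadP => -[b eb]; exists b; move: eb; rewrite bE;
  by have [<-|ne] := eqVneq a b; rewrite /= ?addr0.
Qed.

Lemma incr_nth_partition la a : is_partition la ->
  (a == 0%N) || (nth 0 la a < nth 0 la a.-1)%N -> (a <= size la)%N ->
  is_partition (incr_nth la a).
Proof.
move=> P h le; apply/andP; split.
  apply/(sortedP 0%N) => b _; rewrite !nth_incr_nth /=.
  have := nth_partition b P; case: (a =P b.+1) => [E|_]; last by lia.
  by move: h; rewrite E /=; lia.
apply/allP => x /(nthP 0%N)[b]; rewrite size_incr_nth nth_incr_nth => lt <-.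
have := nth_partition_gt0 b P; move: lt; case: ifP; lia.
Qed.

Definition move_bead (X : nat -> int -> bool) (s : site) (j : nat) (p : int) : bool :=
  if j == s.2 then
    if p == s.1 then false else if p == s.1 + 1 then true else X j p
  else X j p.

Lemma add_node_cfg d nu x : is_bipartition nu -> node_ok d nu x -> is_add x ->
  is_bipartition (add_node nu x) /\ same_cfg (cfg d (add_node nu x)) (move_bead (cfg d nu) (site_of x)).
Proof.
case: nu => la mu /andP[/= P1 P2] /and4P[x2 _ _ /implyP h] /h {h} /and3P[h1 h2 /eqP E].
rewrite /add_node /same_cfg /move_bead /cfg /site_of /= E.
move: x2 h1 h2 {E}; case: (comp x) => [|[|//]] _ /= h1 h2.
  have Q := incr_nth_partition P1 h1 h2.
  split=> [|[|[|]] p] //=; first by rewrite /is_bipartition Q.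
  by move=> _; apply: bead_incr => // b; rewrite nth_incr_nth.
have Q := incr_nth_partition P2 h1 h2.
split=> [|[|[|]] p] //=; first by rewrite /is_bipartition P1.
by move=> _; apply: bead_incr => // b; rewrite nth_incr_nth.
Qed.

Lemma removable_exists c la p : is_partition la -> ~~ bead c la p -> bead c la (p + 1) ->
  exists la', [/\ is_partition la', bead c la' p && ~~ bead c la' (p + 1) &
    forall q, bead c la q = if q == p then false else if q == p + 1 then true else bead c la' q].
Proof.
move=> P nb /beadP[a E].
have h : (nth 0 la a.+1 < nth 0 la a)%N.
  rewrite ltn_neqAle nth_partition // andbT.
  apply: contra nb => /eqP E'; apply/beadP; exists a.+1; move: E; rewrite /bpos E'; lia.
have [||la' P' E'] := @partition_of_fun (fun b => nth 0 la b - (a == b))%N (size la).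
- move=> b; have := nth_partition b P; case: (a =P b) => [<-|_]; last by lia.
  by rewrite ltn_eqF //; lia.
- by rewrite nth_default.
have Ep : bpos c la' a = p by move: E; rewrite /bpos E' eqxx; lia.
exists la'; split=> //; last first.
  move=> q; rewrite (@bead_incr c la' la a) ?Ep //.
  by move=> b; rewrite E'; case: eqP => [<-|]; lia.
apply/andP; split; first by apply/beadP; exists a.
apply/beadP => -[b Eb]; have [ab|ne] := eqVneq a b; first by move: Eb; rewrite -ab Ep; lia.
have : bpos c la' b = bpos c la b by rewrite /bpos E' (negbTE ne) subn0.
by rewrite -Eb E => /(bpos_inj P) e; rewrite e eqxx in ne.
Qed.

Lemma removable_cfg d nu (s : site) : is_bipartition nu -> (s.2 < 2)%N -> sR (cfg d nu) s ->
  exists nu', [/\ is_bipartition nu', sA (cfg d nu') s & same_cfg (cfg d nu) (move_bead (cfg d nu') s)].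
Proof.
case: nu s => la mu [p [|[|//]]] /andP[/= P1 P2] _ /andP[/= nb b].
  have [la' [P' A E]] := removable_exists P1 nb b; exists (la', mu).
  split=> //; first by rewrite /is_bipartition P'.
  by case=> [|[|]] // q _; rewrite /cfg /move_bead /= E.
have [la' [P' A E]] := removable_exists P2 nb b; exists (la, la').
split=> //; first by rewrite /is_bipartition P1.
by case=> [|[|]] // q _; rewrite /cfg /move_bead /= E.
Qed.

Lemma good_all T (A R P : T -> bool) w s : all P w -> good A R w = Some s -> P s /\ A s.
Proof.
elim: w => //= x w IH /andP[px /IH{}IH]; case: ifP => // _; by case: ifP => // ax [<-].
Qed.

Lemma good_mem (T : eqType) (A R : T -> bool) w s : good A R w = Some s -> s \in w /\ A s.
Proof. by apply: good_all; apply/allP. Qed.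

Lemma edge_move_bead d (e : nat) i nu nu' K : (0 < e)%N -> wide K i (cfg d nu) ->
  edge d e nu i nu' <-> [/\ is_bipartition nu, is_bipartition nu' &
    exists2 s, good (sA (cfg d nu)) (sR (cfg d nu)) (sites e i K) = Some s &
      same_cfg (cfg d nu') (move_bead (cfg d nu) s)].
Proof.
move=> e0 w; split=> [[P [x [gx ->]]]|[P P' [s gs E]]].
  have [ok _] := iword_sites e0 P w; have [_ _] := phi_epsE e0 P w.
  rewrite gx /= => gE; move: gx; rewrite good_nodeE => /(good_all ok) [okx ax].
  have [P' S] := add_node_cfg P okx ax.
  by split=> //; exists (site_of x).
(* Conversely, adding the good node produces the prescribed configuration, and a configuration
   determines its bipartition. *)
split=> //; have [ok _] := iword_sites e0 P w; have [_ _] := phi_epsE e0 P w.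
rewrite gs; case gx: (good_node d e i nu) => [x|//] [kx].
exists x; split=> //; move: gx; rewrite good_nodeE => /(good_all ok) [okx ax].
have [P'' S] := add_node_cfg P okx ax.
by apply: (cfg_inj (d := d) P' P'') => j p j2; rewrite E // S // kx.
Qed.

Lemma wide_exists d nu : exists K0, forall K i, (K0 + `|i| <= K)%N -> wide K i (cfg d nu).
Proof.
have one c la : exists K0, forall p, (p <= - K0%:Z -> bead c la p) /\ (K0%:Z <= p -> ~~ bead c la p).
  exists (`|c| + size la + \max_(x <- la) x).+1%N => p; split=> h.
    by rewrite /bead; apply/orP; left; lia.
  apply/norP; split; first by lia.
  apply/mapP => -[a]; rewrite mem_iota /= add0n => lt E.
  have : (nth 0 la a <= \max_(x <- la) x)%N.
    exact: (leq_bigmax_seq (F := id) _ (mem_nth _ _)).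
  by move: E; rewrite /bpos; lia.
have [k1 h1] := one d.1 nu.1; have [k2 h2] := one d.2 nu.2.
exists (k1 + k2)%N => K i le [|j] p _; rewrite /cfg /=; [have := h1 p | have := h2 p];
  case=> u v; split=> h; (apply: u || apply: v); lia.
Qed.

(** * Colours i and i + 1 *)

Lemma fop_good (T : eqType) b (L L' : T -> letter) w s : uniq w ->
  good (upper b \o L) (lower b \o L) w = Some s -> L' s = shift b (L s) ->
  (forall t, t \in w -> t != s -> L' t = L t) -> map L' w = fop b (map L w).
Proof.
elim: w => //= x w IH /andP[nx u] gs Ls E; rewrite nA_map.
case: ifP gs => h gs.
  have [sw _] := good_mem gs.
  rewrite IH // => [|t tw ne]; last by rewrite E // inE tw orbT.
  by rewrite E ?mem_head //; apply: contraNneq nx => ->.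
case: ifP gs => // _ [xs]; subst x; rewrite Ls; congr (_ :: _).
apply/eq_in_map => t tw; apply: E; first by rewrite inE tw orbT.
by apply: contraNneq nx => <-.
Qed.

Definition letter_at (X : nat -> int -> bool) (s : site) : letter :=
  (X s.2 s.1, X s.2 (s.1 + 1), X s.2 (s.1 + 2)).

Definition word e i K X : seq letter := map (letter_at X) (sites e i K).

Definition bshift (b : bool) (s : site) : site := (s.1 + b%:Z, s.2).

Lemma upper_letter_at b X s : upper b (letter_at X s) = sA X (bshift b s).
Proof. by case: b; rewrite /sA /= ?addr0 // -addrA. Qed.

Lemma lower_letter_at b X s : lower b (letter_at X s) = sR X (bshift b s).
Proof. by case: b; rewrite /sR /= ?addr0 // -addrA. Qed.

Definition wide2 K i X := forall b : bool, wide K (i + b%:Z) X.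

Lemma wide2_exists d i (xs : seq bipart) :
  exists K, forall x, x \in xs -> wide2 K i (cfg d x).
Proof.
suff [K0 h] : exists K0, forall x, x \in xs -> forall K j, (K0 + `|j| <= K)%N -> wide K j (cfg d x).
  by exists (K0 + `|i| + 1)%N => x xx b; apply: h => //; case: b; lia.
elim: xs => [|x xs [K0 IH]]; first by exists 0%N.
have [K1 h] := wide_exists d x; exists (K0 + K1)%N => y.
by rewrite inE => /orP[/eqP->|/IH g] K j le; [apply: h | apply: g]; lia.
Qed.

Lemma wide2_le i K K' X : (K <= K')%N -> wide2 K i X -> wide2 K' i X.
Proof.
by move=> le w c j p j2; have [u v] := w c j p j2; split=> ?; [apply: u|apply: v]; lia.
Qed.

Lemma wide2_move_bead i K X Y (s : site) : wide2 K i X -> (s.2 < 2)%N -> sA X s || sR X s ->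
  (forall j p, (j < 2)%N -> j != s.2 \/ (p != s.1 /\ p != s.1 + 1) -> X j p = Y j p) ->
  wide2 K.+2 i Y.
Proof.
move=> w s2 h E.
have [lo hi] : i - K%:Z <= s.1 /\ s.1 + 1 <= i + K%:Z.
  have [v1 u1] := w false _ s.1 s2; have [v2 u2] := w false _ (s.1 + 1) s2.
  rewrite /= addr0 in v1 u1 v2 u2; move: h; rewrite /sA /sR; split.
    by rewrite leNgt; apply/negP => lt; rewrite v1 ?v2 in h; lia.
  by rewrite leNgt; apply/negP => lt; rewrite (negbTE (u1 _)) ?(negbTE (u2 _)) in h; lia.
move=> c j p j2; have [u v] := w false j p j2; rewrite /= addr0 in u v.
split=> h1; rewrite -E //; first [apply: u | apply: v | right]; move: h1; case: (c); lia.
Qed.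

Section Pair.
Variables (d : int * int) (e : nat) (i : int).
Hypothesis e3 : (3 <= e)%N.
Let e0 : (0 < e)%N. Proof. exact: leq_trans e3. Qed.
Local Notation cf := (cfg d).
Local Notation wd K x := (word e i K (cf x)).

Lemma good_word (b : bool) K X : good (sA X) (sR X) (sites e (i + b%:Z) K) =
  omap (bshift b) (good (upper b \o letter_at X) (lower b \o letter_at X) (sites e i K)).
Proof.
rewrite sites_shift (good_map _ _ (bshift b)); congr omap.
have uE s : (upper b \o letter_at X) s = (sA X \o bshift b) s by apply: upper_letter_at.
have lE s : (lower b \o letter_at X) s = (sR X \o bshift b) s by apply: lower_letter_at.
by apply: (eq_in_nA _).2; apply/allP => s _; rewrite uE lE !eqxx.
Qed.

Lemma phi_word (b : bool) K x : is_bipartition x -> wide2 K i (cf x) ->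
  phi d e (i + b%:Z) x = ph b (wd K x) /\ eps d e (i + b%:Z) x = ep b (wd K x).
Proof.
move=> P w; have [-> -> _] := phi_epsE e0 P (w b).
rewrite /word sites_shift !nA_map !nR_map; split.
  by apply: eq_nA => s; apply/esym; [apply: upper_letter_at | apply: lower_letter_at].
by apply: eq_nR => s; apply/esym; [apply: upper_letter_at | apply: lower_letter_at].
Qed.

(** This is where [3 <= e] enters: windows of three cells at distinct sites are disjoint, so one
    bead move changes one letter. *)
Lemma sites_far K s t : s \in sites e i K -> t \in sites e i K -> s.2 = t.2 ->
  t != s -> s.1 + 3 <= t.1 \/ t.1 + 3 <= s.1.
Proof.
move=> /mem_sitesP[_ [q [_ _ E]]] /mem_sitesP[_ [r [_ _ E']]] E2 ne.
have : s.1 <> t.1.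
  by move=> E1; case/negP: ne; apply/eqP; case: s t E1 E2 {E E'} => ? ? [? ?] /= -> ->.
rewrite E E' => ne'; have [lt|lt|Eq] := ltgtP q r; [left; nia|right; nia|].
by case: ne'; rewrite Eq.
Qed.

Lemma letter_at_move_bead (b : bool) K X Y s : s \in sites e i K -> same_cfg Y (move_bead X (bshift b s)) ->
  upper b (letter_at X s) ->
  letter_at Y s = shift b (letter_at X s) /\
  forall t, t \in sites e i K -> t != s -> letter_at Y t = letter_at X t.
Proof.
move=> sw E u; have s2 : (s.2 < 2)%N by case/mem_sitesP: sw.
have at_first Z r : move_bead Z r r.2 r.1 = false by rewrite /move_bead !eqxx.
have at_second Z r : move_bead Z r r.2 (r.1 + 1) = true.
  by rewrite /move_bead !eqxx; case: eqP => // h; exfalso; lia.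
have at_other Z r j p : r.2 <> j \/ (p <> r.1 /\ p <> r.1 + 1) -> move_bead Z r j p = Z j p.
  move=> h; rewrite /move_bead; case: eqP => // h1.
  by case: h => [/(_ (esym h1)) //|[/eqP/negbTE-> /eqP/negbTE->]].
split.
  rewrite /letter_at !E //; move: u {E}; rewrite upper_letter_at /sA.
  have := at_second X (bshift b s); have := at_first X (bshift b s).
  move: (at_other X (bshift b s)); case: b => /= far at_s next_s /andP[].
    rewrite -addrA => h1 h2; rewrite at_s; rewrite -addrA in next_s; rewrite next_s.
    rewrite far; last by right; split; lia.
    by move: h1 h2 => -> /negbTE ->.
  rewrite addr0 in at_s next_s *; rewrite at_s next_s => h1 h2.
  rewrite far; last by right; split; lia.
  by rewrite h1 (negbTE h2).
move=> t tw ne; have t2 : (t.2 < 2)%N by case/mem_sitesP: tw.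
have far p : p - t.1 \in [:: 0; 1; 2] -> s.2 <> t.2 \/ (p <> s.1 + b%:Z /\ p <> s.1 + b%:Z + 1).
  move=> H; case: (s.2 =P t.2) => [st|]; [right|by left].
  have h := sites_far sw tw st ne.
  have b01 : 0 <= b%:Z <= 1 by case: (b).
  have : 0 <= p - t.1 <= 2 by move: H; rewrite !inE => /or3P[] /eqP->.
  move: h b01; move: (b%:Z) => c; lia.
by rewrite /letter_at !E // !at_other //; apply: far; rewrite ?subrr // [X in X \in _]addrC addKr.
Qed.

Lemma edge_word (b : bool) K x y : wide2 K i (cf x) -> edge d e x (i + b%:Z) y ->
  [/\ is_bipartition x, is_bipartition y, wd K y = fop b (wd K x) & 0 < ph b (wd K x)]%N.
Proof.
move=> w /(edge_move_bead y e0 (w b)) [P P' [s]]; rewrite good_word.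
case g: (good _ _ _) => [t|] //= [ts] E; subst s; split=> //.
  have [tw ut] := good_mem g; have [l1 l2] := letter_at_move_bead tw E ut.
  by apply: fop_good g l1 l2; apply: sites_uniq.
rewrite nA_map lt0n; apply/negP => /eqP /nA0_good; by rewrite g.
Qed.

(** The residues [i], [i + 1], [i + 2] are those recorded by letters; edges of colours [i] and
    [i + 1] touch no other. *)
Definition agree_off (x y : bipart) := forall j p, (j < 2)%N ->
  (forall b : int, b \in [:: 0; 1; 2] -> ((p - (i + b)) %% e%:Z)%Z != 0) -> cf x j p = cf y j p.

Lemma edge_agree_off (b : bool) x y : edge d e x (i + b%:Z) y -> agree_off x y.
Proof.
have [K /(_ x (mem_head _ _)) w] := wide2_exists d i [:: x].
move=> /(edge_move_bead y e0 (w b)) [_ _ [s /good_mem[/mem_sitesP[_ [q [_ _ E]]] _] S]] j p j2 h.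
rewrite S // /move_bead; case: ifP => // _; case: ifP => [/eqP Ep|_].
  have /negP[] : ((p - (i + b%:Z)) %% e%:Z)%Z != 0 by apply: h; case: (b).
  by apply/modz_eq0P; exists q; rewrite Ep E.
case: ifP => // /eqP Ep.
have /negP[] : ((p - (i + (b%:Z + 1))) %% e%:Z)%Z != 0 by apply: h; case: (b).
by apply/modz_eq0P; exists q; rewrite Ep E; lia.
Qed.

Lemma agree_off_sym x y : agree_off x y -> agree_off y x.
Proof. by move=> h j p j2 hp; rewrite h. Qed.
Lemma agree_off_trans x y z : agree_off x y -> agree_off y z -> agree_off x z.
Proof. by move=> h g j p j2 hp; rewrite h ?g. Qed.

(** Turns identities between words into identities between vertices: the letters fix three residues
    inside the cut-off, [wide2] the cells beyond it, [agree_off] the remaining residues. *)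
Lemma word_inj K x y : is_bipartition x -> is_bipartition y ->
  wide2 K i (cf x) -> wide2 K i (cf y) -> wd K x = wd K y -> agree_off x y -> x = y.
Proof.
move=> P P' w w' E bxy; apply: (cfg_inj (d := d) P P') => j p j2.
have in_case b : b \in [:: 0; 1; 2] -> ((p - (i + b)) %% e%:Z)%Z == 0 -> cf x j p = cf y j p.
  move=> hb /modz_eq0P[q Ep].
  have b02 : 0 <= b <= 2 by move: hb; rewrite !inE => /or3P[] /eqP->.
  have [lo|lo] := ltP q (- K%:Z).
    have [h _] := w false j p j2; have [h' _] := w' false j p j2; rewrite h ?h' //= addr0; nia.
  have [hi|hi] := leP K%:Z q.
    have [_ h] := w false j p j2; have [_ h'] := w' false j p j2.
    rewrite (negbTE (h _)) ?(negbTE (h' _)) //= addr0; nia.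
  have sw : (e%:Z * q + i, j) \in sites e i K by apply/mem_sitesP; split=> //; exists q.
  have /eq_in_map /(_ _ sw) [] := E.
  have -> : p = e%:Z * q + i + b by lia.
  by move: hb; rewrite !inE => /or3P[] /eqP-> // ; rewrite addr0.
case h0: (((p - (i + 0)) %% e%:Z)%Z == 0); first exact: in_case h0.
case h1: (((p - (i + 1)) %% e%:Z)%Z == 0); first exact: in_case h1.
case h2: (((p - (i + 2)) %% e%:Z)%Z == 0); first exact: in_case h2.
by apply: bxy => // b; rewrite !inE => /or3P[] /eqP->; rewrite ?h0 ?h1 ?h2.
Qed.

Lemma edge_exists (b : bool) x : is_bipartition x -> (0 < phi d e (i + b%:Z) x)%N ->
  exists y, edge d e x (i + b%:Z) y.
Proof.
move=> P; rewrite /phi; case g: (good_node d e (i + b%:Z) x) => [n|].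
  by exists (add_node x n); split=> //; exists n.
by move: g; rewrite good_nodeE => /good_nA0 ->.
Qed.

(** The good letter of the dual word tells which bead to move back. For the resulting [x], its
    outgoing edge is shown to end at a vertex with the word of [y], hence at [y]. *)
Lemma edge_pred (b : bool) y : is_bipartition y -> (0 < eps d e (i + b%:Z) y)%N ->
  exists x, edge d e x (i + b%:Z) y.
Proof.
move=> P; have [K0 /(_ y (mem_head _ _)) w0] := wide2_exists d i [:: y].
(* Two bead moves, from [y] back to [x] and on to [z], each widening the cut-off by 2. *)
pose K := (K0 + 4)%N.
have w : wide2 K i (cf y) by apply: wide2_le w0; rewrite /K; lia.
have [_ ->] := phi_word b P w; rewrite -ph_dual => h.
have dualE X : dual (word e i K X) = map (neg \o letter_at X) (rev (sites e i K)).
  by rewrite /dual /word -map_comp map_rev.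
case g: (good (upper b \o (neg \o letter_at (cf y))) (lower b \o (neg \o letter_at (cf y)))
    (rev (sites e i K))) => [s|]; last first.
  by move: h; rewrite dualE nA_map (good_nA0 g).
have [sw ls] := good_mem g; rewrite mem_rev in sw.
have {}ls : lower b (letter_at (cf y) s) by rewrite -upper_neg.
have s2 : (s.2 < 2)%N by case/mem_sitesP: sw.
move: (ls); rewrite lower_letter_at => R.
have [x [Px A E]] := removable_cfg P (s := bshift b s) s2 R.
have wx2 : wide2 K0.+2 i (cf x).
  apply: (wide2_move_bead w0 (s := bshift b s) s2); first by rewrite R orbT.
  by move=> j p j2 h'; rewrite E // /move_bead; case: eqP h' => // _ [//|[/negbTE-> /negbTE->]].
have wx : wide2 K i (cf x) by apply: wide2_le wx2; rewrite /K; lia.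
have Ux : upper b (letter_at (cf x) s) by rewrite upper_letter_at.
have [l1 l2] := letter_at_move_bead sw E Ux.
have gE : map (neg \o letter_at (cf x)) (rev (sites e i K)) =
   fop b (map (neg \o letter_at (cf y)) (rev (sites e i K))).
  apply: fop_good g _ _; first by rewrite rev_uniq sites_uniq.
    change (neg (letter_at (cf x) s) = shift b (neg (letter_at (cf y) s))).
    by rewrite neg_shift l1 shiftK.
  by move=> t; rewrite mem_rev => tw ne; apply: (congr1 neg); rewrite l2.
rewrite -!dualE in gE.
have Wx : fop b (wd K x) = wd K y by rewrite -[wd K x]dualK gE fop_dual // dualK.
have px : (0 < ph b (wd K x))%N.
  by rewrite -[wd K x]dualK gE ph_dual; have := fop_same h; lia.
have [z xz] : exists z, edge d e x (i + b%:Z) z.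
  by apply: edge_exists => //; rewrite (phi_word b Px wx).1.
have [_ Pz Wz _] := edge_word wx xz.
exists x; suff <- : z = y by [].
have wz : wide2 K i (cf z).
  have /(edge_move_bead z e0 (wx b)) [_ _ [r /good_mem[rw Ar] Er]] := xz.
  have r2 : (r.2 < 2)%N by case/mem_sitesP: rw.
  apply: (@wide2_le i K0.+4); first by rewrite /K; lia.
  apply: (wide2_move_bead wx2 r2); first by rewrite Ar.
  by move=> j p j2 h'; rewrite Er // /move_bead; case: eqP h' => // _ [//|[/negbTE-> /negbTE->]].
apply: (word_inj Pz P wz w); first by rewrite Wz Wx.
apply: (agree_off_trans (agree_off_sym (edge_agree_off xz))) => j p j2 h'.
rewrite E // /move_bead; case: ifP => // /eqP js.
have [_ [q [_ _ Es]]] := mem_sitesP _ _ _ _ sw.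
case: ifP => [/eqP Ep|_].
  have /negP[] : ((p - (i + b%:Z)) %% e%:Z)%Z != 0 by apply: h'; case: (b).
  by apply/modz_eq0P; exists q; rewrite Ep /= Es; lia.
case: ifP => // /eqP Ep.
have /negP[] : ((p - (i + (b%:Z + 1))) %% e%:Z)%Z != 0 by apply: h'; case: (b).
by apply/modz_eq0P; exists q; rewrite Ep /= Es; lia.
Qed.

Local Notation E b x y := (edge d e x (i + Posz (nat_of_bool b)) y).
Local Notation phc b x := (phi d e (i + Posz (nat_of_bool b)) x).
Local Notation epc b x := (eps d e (i + Posz (nat_of_bool b)) x).

(** * The local axioms for two adjacent colours *)

Lemma edge_wide (b : bool) K x y : E b x y ->
  (wide2 K i (cf x) -> wide2 K.+2 i (cf y)) /\ (wide2 K i (cf y) -> wide2 K.+2 i (cf x)).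
Proof.
move=> xy; have [K' /(_ x (mem_head _ _)) w] := wide2_exists d i [:: x].
have /(edge_move_bead y e0 (w b)) [_ _ [s /good_mem[sw A] S]] := xy.
have s2 : (s.2 < 2)%N by case/mem_sitesP: sw.
have far j p : (j < 2)%N -> j != s.2 \/ (p != s.1 /\ p != s.1 + 1) -> cf y j p = cf x j p.
  by move=> j2 h'; rewrite S // /move_bead; case: eqP h' => // _ [//|[/negbTE-> /negbTE->]].
split=> wK; apply: (wide2_move_bead wK s2).
- by rewrite A.
- by move=> j p j2 /far ->.
- rewrite /sR !S // /move_bead !eqxx /=; case: eqP => [h|_]; first by exfalso; lia.
  by rewrite orbT.
- by move=> j p j2 /far ->.
Qed.

Definition good_at K x := is_bipartition x /\ wide2 K i (cf x).

Lemma good_atW K K' x : (K <= K')%N -> good_at K x -> good_at K' x.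
Proof. by move=> le [P w]; split=> //; apply: wide2_le w. Qed.

Lemma good_at_exists x : is_bipartition x -> exists K, good_at K x.
Proof.
by move=> P; have [K /(_ x (mem_head _ _)) w] := wide2_exists d i [:: x]; exists K.
Qed.

Lemma good_fwd b K x y : good_at K x -> E b x y -> good_at K.+2 y.
Proof.
move=> [P w] xy; have [_ Py _ _] := edge_word w xy.
by split=> //; apply: (edge_wide K xy).1.
Qed.

Lemma good_bwd b K x y : good_at K y -> E b x y -> good_at K.+2 x.
Proof. by move=> [P w] xy; split; [case: xy | apply: (edge_wide K xy).2]. Qed.

Lemma phi_at (b : bool) K x : good_at K x -> phc b x = ph b (wd K x) /\ epc b x = ep b (wd K x).
Proof. by case=> P w; apply: phi_word. Qed.

Lemma edgew (b : bool) K x y : good_at K x -> E b x y ->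
  wd K y = fop b (wd K x) /\ (0 < ph b (wd K x))%N.
Proof. by move=> [P w] /(edge_word w) [_ _ -> ->]. Qed.

Lemma ex_edge (b : bool) K x : good_at K x -> (0 < ph b (wd K x))%N -> exists y, E b x y.
Proof. by move=> g; rewrite -(phi_at b g).1; apply: edge_exists; case: g. Qed.

Lemma ex_pred (b : bool) K y : good_at K y -> (0 < ep b (wd K y))%N -> exists x, E b x y.
Proof. by move=> g; rewrite -(phi_at b g).2; apply: (edge_pred); case: g. Qed.

Lemma eq_word K x y : good_at K x -> good_at K y -> wd K x = wd K y -> agree_off x y -> x = y.
Proof. by move=> [P w] [P' w']; apply: (word_inj). Qed.

Lemma pair_inj (b : bool) x y z : E b x z -> E b y z -> x = y.
Proof.
move=> xz yz; have Pz : is_bipartition x by case: xz.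
have [K0 gx0] := good_at_exists Pz.
have gz0 := good_fwd gx0 xz; have gy := good_bwd gz0 yz.
have gx : good_at K0.+4 x by apply: good_atW gx0; lia.
have [w1 p1] := edgew gx xz; have [w2 p2] := edgew gy yz.
apply: (eq_word gx gy); first by apply: (fop_inj p1 p2); rewrite -w1.
exact: (agree_off_trans (edge_agree_off xz) (agree_off_sym (edge_agree_off yz))).
Qed.

Lemma pair_stats (b : bool) x y : E b x y ->
  [/\ phc b x = (phc b y).+1, epc b y = (epc b x).+1 &
   (phc (~~ b) y = (phc (~~ b) x).+1 /\ epc (~~ b) y = epc (~~ b) x) \/
   (phc (~~ b) y = phc (~~ b) x /\ epc (~~ b) x = (epc (~~ b) y).+1)].
Proof.
move=> xy; have [K0 gx0] := @good_at_exists x (proj1 xy); have gy := good_fwd gx0 xy.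
have gx : good_at K0.+2 x by apply: good_atW gx0; lia.
have [w1 p1] := edgew gx xy.
have [-> ->] := phi_at b gx; have [-> ->] := phi_at b gy.
have [-> ->] := phi_at (~~ b) gx; have [-> ->] := phi_at (~~ b) gy.
by rewrite w1; have [-> ->] := fop_same p1; split=> //; apply: fop_other.
Qed.

Lemma pair_square (b : bool) w x z : E b w x -> E (~~ b) w z ->
  ~~ ((phc (~~ b) x == (phc (~~ b) w).+1) && (phc b z == (phc b w).+1)) ->
  exists2 y, E (~~ b) x y & E b z y.
Proof.
move=> wx wz ni; have [K0 gw0] := @good_at_exists w (proj1 wx).
have gx0 := good_fwd gw0 wx; have gz0 := good_fwd gw0 wz.
pose K := (K0 + 4)%N; have up K' t : (K' <= K)%N -> good_at K' t -> good_at K t.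
  by move=> le; apply: good_atW.
have gw : good_at K w by apply: up gw0; rewrite /K; lia.
have gx : good_at K x by apply: up gx0; rewrite /K; lia.
have gz : good_at K z by apply: up gz0; rewrite /K; lia.
have [w1 p1] := edgew gw wx; have [w2 p2] := edgew gw wz.
have o1 := fop_other p1; have o2 := fop_other p2; rewrite negbK in o2.
have [|y xy] := ex_edge (b := ~~ b) gx; first by rewrite w1; lia.
have [|y' zy] := ex_edge (b := b) gz; first by rewrite w2; lia.
have gy : good_at K y by apply: up (good_fwd gx0 xy); rewrite /K; lia.
have gy' : good_at K y' by apply: up (good_fwd gz0 zy); rewrite /K; lia.
have [w3 _] := edgew gx xy; have [w4 _] := edgew gz zy.
suff yy : y = y' by exists y => //; rewrite yy.
apply: (eq_word gy gy'); last first.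
  have h1 := agree_off_trans (edge_agree_off wx) (edge_agree_off xy).
  have h2 := agree_off_trans (edge_agree_off wz) (edge_agree_off zy).
  exact: agree_off_trans (agree_off_sym h1) h2.
rewrite w3 w4 w1 w2; apply/esym/fop_square => //; rewrite /inc negbK.
move: ni; rewrite (phi_at _ gx).1 (phi_at _ gw).1 (phi_at _ gz).1 (phi_at _ gw).1 w1 w2.
by [].
Qed.

Lemma pair_octagon (b : bool) w x z : E b w x -> E (~~ b) w z ->
  (phc (~~ b) x == (phc (~~ b) w).+1) && (phc b z == (phc b w).+1) ->
  exists a a' c c' y, [/\ E (~~ b) x a, E (~~ b) a a' & E b a' y] /\
    [/\ E b z c, E b c c' & E (~~ b) c' y].
Proof.
move=> wx wz; have [K0 gw0] := @good_at_exists w (proj1 wx).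
have gx0 := good_fwd gw0 wx; have gz0 := good_fwd gw0 wz.
(* Each side of the octagon has four edges from [w], each costing 2. *)
pose K := (K0 + 8)%N; have up K' t : (K' <= K)%N -> good_at K' t -> good_at K t.
  by move=> le; apply: good_atW.
have gw : good_at K w by apply: up gw0; rewrite /K; lia.
have gx : good_at K x by apply: up gx0; rewrite /K; lia.
have gz : good_at K z by apply: up gz0; rewrite /K; lia.
have [w1 p1] := edgew gw wx; have [w2 p2] := edgew gw wz.
rewrite (phi_at _ gx).1 (phi_at _ gw).1 (phi_at _ gz).1 (phi_at _ gw).1 w1 w2 => /andP[I1 I2].
have I2' : inc (~~ b) (wd K w) by rewrite /inc negbK.
have [a1 a2 a3 _ _] := octagon_stats p1 p2 I1 I2'.
have := @octagon_stats (~~ b) (wd K w) p2; rewrite negbK => /(_ p1 I2' I1) [b1 b2 b3 _ _].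
have [|a xa] := ex_edge (b := ~~ b) gx; first by rewrite w1.
have ga0 := good_fwd gx0 xa; have [w3 _] := edgew gx xa.
have ga : good_at K a by apply: up ga0; rewrite /K; lia.
have [|a' aa] := ex_edge (b := ~~ b) ga; first by rewrite w3 w1.
have ga0' := good_fwd ga0 aa; have [w4 _] := edgew ga aa.
have ga' : good_at K a' by apply: up ga0'; rewrite /K; lia.
have [|y ay] := ex_edge (b := b) ga'; first by rewrite w4 w3 w1.
have gy : good_at K y by apply: up (good_fwd ga0' ay); rewrite /K; lia.
have [w5 _] := edgew ga' ay.
have [|c zc] := ex_edge (b := b) gz; first by rewrite w2.
have gc0 := good_fwd gz0 zc; have [v3 _] := edgew gz zc.
have gc : good_at K c by apply: up gc0; rewrite /K; lia.
have [|c' cc] := ex_edge (b := b) gc; first by rewrite v3 w2.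
have gc0' := good_fwd gc0 cc; have [v4 _] := edgew gc cc.
have gc' : good_at K c' by apply: up gc0'; rewrite /K; lia.
have [|y' cy] := ex_edge (b := ~~ b) gc'; first by rewrite v4 v3 w2.
have gy' : good_at K y' by apply: up (good_fwd gc0' cy); rewrite /K; lia.
have [v5 _] := edgew gc' cy.
exists a, a', c, c', y; split=> //; suff -> : y = y' by [].
apply: (eq_word gy gy').
  by rewrite w5 w4 w3 w1 v5 v4 v3 w2; have [] := fop_octagon p1 p2 I1 I2'.
have h1 := agree_off_trans (agree_off_trans (edge_agree_off wx) (edge_agree_off xa)) (agree_off_trans (edge_agree_off aa) (edge_agree_off ay)).
have h2 := agree_off_trans (agree_off_trans (edge_agree_off wz) (edge_agree_off zc)) (agree_off_trans (edge_agree_off cc) (edge_agree_off cy)).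
exact: agree_off_trans (agree_off_sym h1) h2.
Qed.

Lemma pair_confl (b : bool) x y z : E b x y -> E (~~ b) z y ->
  (exists w, [/\ E (~~ b) w x, E b w z &
     ~~ ((phc (~~ b) z == (phc (~~ b) w).+1) && (phc b x == (phc b w).+1))]) \/
  (exists w a a' c c', [/\ E b w a, E (~~ b) a a' & E (~~ b) a' x] /\
     [/\ E (~~ b) w c, E b c c' & E b c' z] /\
     (phc (~~ b) a == (phc (~~ b) w).+1) && (phc b c == (phc b w).+1)).
Proof.
move=> xy zy; have [K0 gx0] := @good_at_exists x (proj1 xy).
have gy0 := good_fwd gx0 xy; have gz0 := good_bwd gy0 zy.
(* Six edges are walked from [x] in the octagon case: three down to [w], three up to [z']. *)
pose K := (K0 + 12)%N; have up K' t : (K' <= K)%N -> good_at K' t -> good_at K t.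
  by move=> le; apply: good_atW.
have gx : good_at K x by apply: up gx0; rewrite /K; lia.
have gz : good_at K z by apply: up gz0; rewrite /K; lia.
have [w1 p1] := edgew gx xy; have [w2 p2] := edgew gz zy.
have bxz : agree_off x z := agree_off_trans (edge_agree_off xy) (agree_off_sym (edge_agree_off zy)).
case: (fop_confl p1 p2); first by rewrite -w1.
  case=> v [v1 v2 ni vx vz]; left.
  have [|w wx] := ex_pred (b := ~~ b) gx; first by rewrite -vx (fop_same v2).2.
  have gw0 := good_bwd gx0 wx.
  have gw : good_at K w by apply: up gw0; rewrite /K; lia.
  have [x1 x2] := edgew gw wx.
  have wv : wd K w = v by apply: (fop_inj x2 v2); rewrite -x1.
  have [|z' wz'] := ex_edge (b := b) gw; first by rewrite wv.
  have [z1 _] := edgew gw wz'.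
  have zz : z' = z.
    apply: (eq_word (K := K)) => //; first by apply: up (good_fwd gw0 wz'); rewrite /K; lia.
      by rewrite z1 wv.
    exact: agree_off_trans (agree_off_sym (edge_agree_off wz')) (agree_off_trans (edge_agree_off wx) bxz).
  exists w; split=> //; first by rewrite -zz.
  rewrite (phi_at _ gx).1 (phi_at _ gw).1 (phi_at _ gz).1 (phi_at _ gw).1 wv -vx -vz.
  by move: ni; rewrite /inc negbK.
case=> v [v1 v2 /andP[I1 I2] vx vz]; right.
have [a1 a2 a3 _ _] := octagon_stats v1 v2 I1 I2.
have := @octagon_stats (~~ b) v v2; rewrite negbK => /(_ v1 I2 I1) [b1 b2 b3 _ _].
have [|a' ax] := ex_pred (b := ~~ b) gx; first by rewrite -vx (fop_same a2).2.
have ga0' := good_bwd gx0 ax; have ga' : good_at K a' by apply: up ga0'; rewrite /K; lia.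
have [x1 x2] := edgew ga' ax.
have wa' : wd K a' = fop (~~ b) (fop b v) by apply: (fop_inj x2 a2); rewrite -x1.
have [|a aa] := ex_pred (b := ~~ b) ga'; first by rewrite wa' (fop_same a1).2.
have ga0 := good_bwd ga0' aa; have ga : good_at K a by apply: up ga0; rewrite /K; lia.
have [x3 x4] := edgew ga aa.
have wa : wd K a = fop b v by apply: (fop_inj x4 a1); rewrite -x3.
have [|w wa_] := ex_pred (b := b) ga; first by rewrite wa (fop_same v1).2.
have gw0 := good_bwd ga0 wa_; have gw : good_at K w by apply: up gw0; rewrite /K; lia.
have [x5 x6] := edgew gw wa_.
have ww : wd K w = v by apply: (fop_inj x6 v1); rewrite -x5.
have [|c wc] := ex_edge (b := ~~ b) gw; first by rewrite ww.
have gc0 := good_fwd gw0 wc; have gc : good_at K c by apply: up gc0; rewrite /K; lia.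
have [y1 _] := edgew gw wc.
have [|c' cc] := ex_edge (b := b) gc; first by rewrite y1 ww.
have gc0' := good_fwd gc0 cc; have gc' : good_at K c' by apply: up gc0'; rewrite /K; lia.
have [y2 _] := edgew gc cc.
have [|z' cz] := ex_edge (b := b) gc'; first by rewrite y2 y1 ww.
have gz' : good_at K z' by apply: up (good_fwd gc0' cz); rewrite /K; lia.
have [y3 _] := edgew gc' cz.
have zz : z' = z.
  apply: (eq_word gz' gz); first by rewrite y3 y2 y1 ww.
  have h1 := agree_off_trans (edge_agree_off wc) (agree_off_trans (edge_agree_off cc) (edge_agree_off cz)).
  have h2 := agree_off_trans (edge_agree_off wa_) (agree_off_trans (edge_agree_off aa) (edge_agree_off ax)).
  exact: agree_off_trans (agree_off_sym h1) (agree_off_trans h2 bxz).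
exists w, a, a', c, c'; rewrite -zz; split=> //; split=> //.
rewrite (phi_at _ ga).1 (phi_at _ gw).1 (phi_at _ gc).1 (phi_at _ gw).1 wa y1 ww.
by move: I1 I2; rewrite /inc negbK => -> ->.
Qed.

End Pair.

(** * The crystal axioms *)

Definition same (e : nat) (i j : int) : bool := ((i - j) %% e%:Z)%Z == 0.
Definition adj (e : nat) (i j : int) : nat := (same e j (i + 1) + same e i (j + 1))%N.

Lemma sameP e i j : reflect (exists q : int, i = e%:Z * q + j) (same e i j).
Proof. exact: modz_eq0P. Qed.

Lemma same_iword d e i j nu : same e i j -> iword d e i nu = iword d e j nu.
Proof.
case/sameP => q ->; rewrite /iword; congr sort; apply: eq_filter => x.
apply/modz_eq0P/modz_eq0P => -[r ->]; [exists (r + q) | exists (r - q)]; lia.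
Qed.

Lemma same_edge d e i j x y : same e i j -> edge d e x i y -> edge d e x j y.
Proof.
by move=> s [P [n [g E]]]; split=> //; exists n; split=> //; rewrite good_nodeE -(same_iword d x s) -good_nodeE.
Qed.

Lemma same_sym e i j : same e i j = same e j i.
Proof. by apply/sameP/sameP => -[q ->]; exists (- q); lia. Qed.

Lemma common_wide (d : int * int) (i j : int) (xs : seq bipart) : exists K, forall x, x \in xs ->
  wide K i (cfg d x) /\ wide K j (cfg d x).
Proof.
have [K1 h1] := wide2_exists d i xs; have [K2 h2] := wide2_exists d j xs.
exists (K1 + K2)%N => x xx; have := h1 x xx false; have := h2 x xx false; rewrite !addr0.
move=> w1 w2; split=> k p k2; [have [u v] := w2 k p k2 | have [u v] := w1 k p k2]; split=> h;
  (apply: u || apply: v); lia.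
Qed.

Section Far.
Variables (d : int * int) (e : nat).
Hypothesis e0 : (0 < e)%N.

Lemma move_bead_off X s j p : p != s.1 -> p != s.1 + 1 -> move_bead X s j p = X j p.
Proof. by rewrite /move_bead => /negbTE-> /negbTE->; case: ifP. Qed.

Variables i j : int.
Hypotheses (nij : ~~ same e i j) (nadj : adj e i j = 0%N).

Lemma far_pos K K' s t : s \in sites e i K -> t \in sites e j K' ->
  [/\ t.1 != s.1, t.1 != s.1 + 1, t.1 + 1 != s.1 & t.1 + 1 != s.1 + 1].
Proof.
clear e0; move=> /mem_sitesP[_ [q [_ _ Es]]] /mem_sitesP[_ [r [_ _ Et]]].
have [n1 n2] : ~~ same e j (i + 1) /\ ~~ same e i (j + 1).
  by move: nadj; rewrite /adj; case: same; case: same.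
split; apply/eqP => h; rewrite Es Et in h; [case/negP: nij | case/negP: n1 | case/negP: n2 | case/negP: nij];
  apply/sameP; [exists (r - q) | exists (q - r) | exists (r - q) | exists (r - q)]; rewrite mulrBr; lia.
Qed.

Lemma far_good K s X Y : s \in sites e i K -> same_cfg Y (move_bead X s) ->
  all (fun t => (sA Y t == sA X t) && (sR Y t == sR X t)) (sites e j K).
Proof.
move=> sw E; apply/allP => t tw; have [h1 h2 h3 h4] := far_pos sw tw.
have t2 : (t.2 < 2)%N by case/mem_sitesP: tw.
by rewrite /sA /sR !E // !move_bead_off // !eqxx.
Qed.

Lemma far_stats x y : edge d e x i y ->
  phi d e j y = phi d e j x /\ eps d e j y = eps d e j x.
Proof.
move=> xy; have [K w] := common_wide d i j [:: x; y].
have [wx wxj] := w x (mem_head _ _); have [_ wyj] := w y (mem_last x [:: y]).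
have [Px Py [s /good_mem[sw _] S]] := (edge_move_bead y e0 wx).1 xy.
have [-> -> _] := phi_epsE e0 Px wxj; have [-> -> _] := phi_epsE e0 Py wyj.
have a := far_good sw S; split; [exact: (eq_in_nA a).1 | exact: eq_in_nR a].
Qed.

End Far.

Section Crystal.
Variables (d : int * int) (e : nat).
Hypothesis e3 : (3 <= e)%N.
Let e0 : (0 < e)%N. Proof. exact: leq_trans e3. Qed.

Lemma edge_exists0 i x : is_bipartition x -> (0 < phi d e i x)%N -> exists y, edge d e x i y.
Proof. by move=> P; have := @edge_exists d e i false x P; rewrite addr0. Qed.

Lemma edge_pred0 i y : is_bipartition y -> (0 < eps d e i y)%N -> exists x, edge d e x i y.
Proof. by move=> P; have := @edge_pred d e i e3 false y P; rewrite addr0. Qed.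

Lemma edge_bip i x y : edge d e x i y -> is_bipartition x /\ is_bipartition y.
Proof.
move=> xy; split; first by case: xy.
have [K w] := common_wide d i i [:: x]; have [wx _] := w x (mem_head _ _).
by have [] := (edge_move_bead y e0 wx).1 xy.
Qed.

Lemma edge_same i x y : edge d e x i y ->
  phi d e i x = (phi d e i y).+1 /\ eps d e i y = (eps d e i x).+1.
Proof. by move=> xy; have := @pair_stats d e i e3 false x y; rewrite addr0 => /(_ xy) []. Qed.

Lemma edge_inj0 i x y z : edge d e x i z -> edge d e y i z -> x = y.
Proof. by have := @pair_inj d e i e3 false x y z; rewrite addr0. Qed.

Lemma far_square i j w x z : ~~ same e i j -> adj e i j = 0%N ->
  edge d e w i x -> edge d e w j z -> exists2 y, edge d e x j y & edge d e z i y.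
Proof.
move=> nij nadj wx wz.
have nji : ~~ same e j i by rewrite same_sym.
have nadj' : adj e j i = 0%N by rewrite /adj addnC.
have [y xy] : exists y, edge d e x j y.
  apply: edge_exists0; first exact: (edge_bip wx).2.
  by rewrite (far_stats e0 nij nadj wx).1 (edge_same wz).1.
have [y' zy] : exists y, edge d e z i y.
  apply: edge_exists0; first exact: (edge_bip wz).2.
  by rewrite (far_stats e0 nji nadj' wz).1 (edge_same wx).1.
suff yy : y = y' by exists y => //; rewrite yy.
have [K h] := common_wide d i j [:: w; x; z].
have [wwi wwj] := h w (mem_head _ _).
have [_ wxj] : wide K i (cfg d x) /\ wide K j (cfg d x) by apply: h; rewrite !inE eqxx orbT.
have [wzi _] : wide K i (cfg d z) /\ wide K j (cfg d z) by apply: h; rewrite !inE eqxx !orbT.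
have [_ _ [s gs Ex]] := (edge_move_bead x e0 wwi).1 wx; have [sw _] := good_mem gs.
have [_ _ [t gt Ez]] := (edge_move_bead z e0 wwj).1 wz; have [tw _] := good_mem gt.
have [_ Py [t' gt' Ey]] := (edge_move_bead y e0 wxj).1 xy.
have [_ Py' [s' gs' Ey']] := (edge_move_bead y' e0 wzi).1 zy.
have tt : t' = t.
  by move: gt'; rewrite (eq_in_nA (far_good nij nadj sw Ex)).2 gt => -[].
have ss : s' = s.
  by move: gs'; rewrite (eq_in_nA (far_good nji nadj' tw Ez)).2 gs => -[].
subst t' s'; have [p1 p2 p3 p4] := far_pos nij nadj sw tw.
apply: (cfg_inj (d := d) Py Py') => k p k2.
have {}Ex := Ex k p k2; have {}Ez := Ez k p k2.
rewrite Ey // Ey' // /move_bead Ex Ez /move_bead.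
case: (k == s.2); case: (k == t.2) => //.
case: (p =P t.1) => [->|_]; first by rewrite (negbTE p1) (negbTE p2).
case: (p =P t.1 + 1) => [->|_]; first by rewrite (negbTE p3) (negbTE p4).
by [].
Qed.

Lemma edge_confl_far i j x y z : ~~ same e i j -> adj e i j = 0%N ->
  edge d e x i y -> edge d e z j y -> exists2 w, edge d e w j x & edge d e w i z.
Proof.
move=> nij nadj xy zy.
have [w wx] : exists w, edge d e w j x.
  apply: edge_pred0; first exact: (edge_bip xy).1.
  by rewrite -(far_stats e0 nij nadj xy).2 (edge_same zy).2.
have nji : ~~ same e j i by rewrite same_sym.
have nadj' : adj e j i = 0%N by rewrite /adj addnC.
have [z' wz'] : exists z', edge d e w i z'.
  apply: edge_exists0; first exact: (edge_bip wx).1.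
  by rewrite -(far_stats e0 nji nadj' wx).1 (edge_same xy).1.
exists w => //; have [y' zy' xy'] := far_square nij nadj wz' wx.
have yy : y' = y.
  by move: xy' xy => [_ [n [g ->]]] [_ [n' [g' ->]]]; move: g'; rewrite g => -[->].
by rewrite yy in zy'; rewrite (edge_inj0 zy zy').
Qed.

Lemma phi_sameE i j x : same e i j -> phi d e i x = phi d e j x.
Proof. by move=> s; rewrite /phi (same_iword d x s). Qed.
Lemma eps_sameE i j x : same e i j -> eps d e i x = eps d e j x.
Proof. by move=> s; rewrite /eps (same_iword d x s). Qed.
Lemma edge_sameE i j x y : same e i j -> edge d e x i y <-> edge d e x j y.
Proof. by move=> s; split; apply: same_edge => //; rewrite same_sym. Qed.

(** Adjacency in both directions would make [e] divide 2. The base [k] is the smaller of the two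
    consecutive residues. *)
Lemma near_pair i j : ~~ same e i j -> adj e i j <> 0%N -> adj e i j = 1%N /\
  exists k (b : bool), same e i (k + b%:Z) /\ same e j (k + (~~ b)%:Z).
Proof.
move=> nij; rewrite /adj.
case h1: (same e j (i + 1)); case h2: (same e i (j + 1)) => // _; last first.
- by split=> //; exists j, true; split=> //; apply/sameP; exists 0; lia.
- by split=> //; exists i, false; split=> //; apply/sameP; exists 0; lia.
exfalso; move/sameP: h1 => [q1 E1]; move/sameP: h2 => [q2 E2].
have [q0|q1'] : q1 + q2 = 0 \/ (q1 + q2 != 0) by case: eqP; auto.
  nia.
nia.
Qed.

Lemma edge_crystal : crystal (same e) (adj e) is_bipartition (fun i x y => edge d e x i y)
  (eps d e) (phi d e).
Proof.
split.
- exact: edge_bip.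
- by move=> i x y z [_ [n [g ->]]] [_ [n' [g' ->]]]; move: g'; rewrite g => -[->].
- exact: edge_inj0.
- by move=> i j x y; apply: same_edge.
- by move=> i x; apply: edge_exists0.
- by move=> i x; apply: edge_pred0.
- exact: edge_same.
- by move=> i j x _; apply: phi_sameE.
- by move=> i j x _; apply: eps_sameE.
- move=> i j x y nij xy; case: (adj e i j =P 0%N) => [n0|/(near_pair nij)[-> [k [b [si sj]]]]].
    by have [-> ->] := far_stats e0 nij n0 xy; rewrite n0 addn0.
  rewrite !(phi_sameE _ sj) !(eps_sameE _ sj).
  have [_ _ []] := pair_stats e3 ((edge_sameE x y si).1 xy) => -[-> ->]; lia.
- move=> i j w x z nij wx wz; case: (adj e i j =P 0%N) => [n0 _|/(near_pair nij)[_ [k [b [si sj]]]]].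
    exact: far_square nij n0 wx wz.
  rewrite !(phi_sameE _ sj) !(phi_sameE _ si) => h.
  have [y xy zy] := pair_square e3 ((edge_sameE w x si).1 wx) ((edge_sameE w z sj).1 wz) h.
  by exists y; [apply/(edge_sameE x y sj) | apply/(edge_sameE z y si)].
- move=> i j w x z nij wx wz; case: (adj e i j =P 0%N) => [n0|/(near_pair nij)[_ [k [b [si sj]]]]].
    by rewrite (far_stats e0 nij n0 wx).1 => /andP[/eqP]; lia.
  rewrite !(phi_sameE _ sj) !(phi_sameE _ si) => h.
  have [a [a' [c [c' [y [[h1 h2 h3] [h4 h5 h6]]]]]]] :=
    pair_octagon e3 ((edge_sameE w x si).1 wx) ((edge_sameE w z sj).1 wz) h.
  by exists a, a', c, c', y; split; split; apply/(edge_sameE _ _ sj) || apply/(edge_sameE _ _ si).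
- move=> i j x y z nij xy zy; case: (adj e i j =P 0%N) => [n0|/(near_pair nij)[_ [k [b [si sj]]]]].
    left; have [w wx wz] := edge_confl_far nij n0 xy zy; exists w; split=> //.
    by rewrite (far_stats e0 nij n0 wz).1 negb_and; apply/orP; left; apply/eqP; lia.
  case: (pair_confl e3 ((edge_sameE x y si).1 xy) ((edge_sameE z y sj).1 zy)).
    case=> w [wx wz h]; left; exists w; split; first by apply/(edge_sameE _ _ sj).
      by apply/(edge_sameE _ _ si).
    by rewrite !(phi_sameE _ sj) !(phi_sameE _ si).
  case=> w [a [a' [c [c' [[h1 h2 h3] [[h4 h5 h6] h]]]]]]; right; exists w, a, a', c, c'.
  split; [|split]; last by rewrite !(phi_sameE _ sj) !(phi_sameE _ si).
    by split; apply/(edge_sameE _ _ sj) || apply/(edge_sameE _ _ si).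
  by split; apply/(edge_sameE _ _ sj) || apply/(edge_sameE _ _ si).
Qed.

End Crystal.

(** * Partitions from beta-sets *)

(* The beta-set X as a Maya diagram: all negative positions carry beads. *)
Definition maya (X : seq nat) (x : int) : bool := (x < 0) || (`|x|%N \in X).

Lemma nth_filter_pos l a : sorted geq l -> nth 0%N [seq x <- l | (0 < x)%N] a = nth 0%N l a.
Proof.
elim: l a => // x l IH a /= s; case: ifP => [_|/negbT].
  by case: a => //= a; apply: IH; apply: path_sorted s.
rewrite -eqn0Ngt => /eqP x0; subst x.
have a0 : all (fun x => x == 0%N) l.
  have := order_path_min (rev_trans leq_trans) s.
  by apply: sub_all => y; rewrite /= leqn0.
rewrite (eq_in_filter (a2 := pred0)) ?filter_pred0 ?nth_nil; last first.
  by move=> y /(allP a0) /= /eqP->.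
case: a => //= a; have [lt|ge] := ltnP a (size l); last by rewrite nth_default.
by have /eqP-> := allP a0 _ (mem_nth 0%N lt).
Qed.

Section PartOfBeta.
Variable X : seq nat.
Let s := sort geq (undup X).
Let n := size (undup X).

Let s_size : size s = n. Proof. by rewrite size_sort. Qed.

Let s_sorted : sorted gtn s.
Proof.
have t : sorted geq s by apply: sort_sorted => x y; apply: leq_total.
have u : uniq s by rewrite sort_uniq undup_uniq.
have := sorted_pairwise (rev_trans leq_trans : transitive geq) s; rewrite t => /esym pw.
have : pairwise (fun x y => geq x y && (x != y)) s.
  by rewrite pairwise_relI pw -uniq_pairwise.
rewrite (@sorted_pairwise _ gtn); last by move=> x y z /= h1 h2; apply: ltn_trans h2 h1.
by apply: sub_pairwise => x y /andP[/= h1 h2]; rewrite ltn_neqAle eq_sym h2.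
Qed.

Let nth_s_lt a b : (a < b < n)%N -> (nth 0 s b < nth 0 s a)%N.
Proof.
case/andP=> ab bn; have tr : transitive gtn by move=> x y z /= h1 h2; apply: ltn_trans h2 h1.
have h := sorted_ltn_nth tr 0%N s_sorted.
by apply: h; rewrite ?inE ?s_size //; apply: ltn_trans bn.
Qed.

Let nth_s_ge a : (a < n)%N -> (n - 1 - a <= nth 0 s a)%N.
Proof.
move=> an; suff : forall k, (k < n)%N -> (k <= nth 0 s (n - 1 - k))%N.
  by move=> /(_ (n - 1 - a)%N); rewrite (_ : n - 1 - (n - 1 - a) = a)%N; lia.
elim=> // k IH kn; apply: leq_ltn_trans (IH _) _; [lia|]; apply: nth_s_lt; lia.
Qed.

Let f a := (nth 0 s a - (size s - 1 - a))%N.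

Let nth_pob a : nth 0%N (part_of_beta X) a = if (a < n)%N then f a else 0%N.
Proof.
rewrite /part_of_beta -/s nth_filter_pos.
  case: ifP => an; first by rewrite (nth_map 0%N) ?size_iota ?nth_iota ?s_size // add0n /f s_size.
  by rewrite nth_default // size_map size_iota s_size leqNgt an.
apply/(sortedP 0%N) => i; rewrite size_map size_iota => h.
rewrite !(nth_map 0%N) ?size_iota //; try lia.
rewrite !nth_iota //; try lia.
rewrite !add0n; have := @nth_s_lt i i.+1; rewrite -s_size h ltnSn /= => /(_ isT); lia.
Qed.

Lemma part_of_beta_partition : is_partition (part_of_beta X).
Proof.
apply/andP; split; last by apply/allP => x; rewrite mem_filter => /andP[].
apply: (sorted_filter (rev_trans leq_trans : transitive geq)).
apply/(sortedP 0%N) => i; rewrite size_map size_iota -/s => h.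
rewrite !(nth_map 0%N) ?size_iota //; try lia.
rewrite !nth_iota //; try lia.
rewrite !add0n; have := @nth_s_lt i i.+1; rewrite -s_size h ltnSn /= => /(_ isT); lia.
Qed.

(** With the beads 0, ..., n - 1 the partition is empty and its last bead, at n - 1, has content
    [c]; this fixes the translation. *)
Lemma bead_part_of_beta c p :
  bead c (part_of_beta X) p = maya X (p - c + n%:Z - 1).
Proof.
apply/beadP/orP => [[a ->]|[lt|]].
- rewrite /bpos nth_pob; case: ltnP => an; [right|left; lia].
  rewrite (_ : `|_|%N = nth 0%N s a).
    by rewrite -mem_undup -(mem_sort geq) mem_nth // s_size.
  by rewrite /f s_size; have := nth_s_ge an; lia.
- exists `|(p - c)%R|%N; rewrite /bpos nth_pob ifF; lia.
case: (ltP (p - c + n%:Z - 1) 0) => [lt _|ge].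
  by exists `|(p - c)%R|%N; rewrite /bpos nth_pob ifF; lia.
rewrite -mem_undup -(mem_sort geq) => h; exists (index `|(p - c + n%:Z - 1)%R|%N s).
have an : (index `|(p - c + n%:Z - 1)%R|%N s < n)%N by rewrite -[X in (_ < X)%N]s_size index_mem.
have := nth_s_ge an; rewrite /bpos nth_pob an /f s_size nth_index //; lia.
Qed.

End PartOfBeta.

Lemma mem_beta_set N la x : (size la <= N)%N ->
  (x \in beta_set N la) = bead 0 la (x%:Z - N%:Z + 1).
Proof.
move=> le; apply/mapP/beadP => -[a].
  by rewrite mem_iota => lt ->; exists a; rewrite /bpos; lia.
rewrite /bpos => E; have [aN|aN] := ltnP a N; last by move: E; rewrite nth_default; lia.
by exists a; [rewrite mem_iota | lia].
Qed.

Lemma maya_beta_set N la x : (size la <= N)%N -> maya (beta_set N la) x = bead 0 la (x - N%:Z + 1).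
Proof.
move=> le; rewrite /maya; case: (ltP x 0) => [lt|ge] /=.
  by apply/esym; rewrite /bead; apply/orP; left; lia.
by rewrite mem_beta_set //; congr bead; lia.
Qed.

Lemma beta_set_uniq N la : is_partition la -> (size la <= N)%N -> uniq (beta_set N la).
Proof.
move=> P le; rewrite map_inj_in_uniq ?iota_uniq // => a b; rewrite !mem_iota => la_ lb E.
by apply: (bpos_inj P (c := 0)); rewrite /bpos; lia.
Qed.

(** * Cores and staircases *)

Definition core_beads (p : nat) (X : seq nat) : seq nat :=
  flatten [seq [seq (r + p * k)%N | k <- iota 0 (count (fun x => x %% p == r)%N X)] | r <- iota 0 p].

Lemma mem_core_beads p X x : (0 < p)%N ->
  (x \in core_beads p X) = (x %/ p < count (fun y => y %% p == x %% p) X)%N.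
Proof.
move=> p0; apply/flattenP/idP => [[s /mapP[r]]|h].
  rewrite mem_iota => /andP[_ rp] -> /mapP[k]; rewrite mem_iota => /andP[_ lt] ->.
  by rewrite addnC mulnC divnMDl // divn_small // addn0 modnMDl modn_small.
exists [seq (x %% p + p * k)%N | k <- iota 0 (count (fun y => y %% p == x %% p)%N X)].
  by apply/mapP; exists (x %% p)%N => //; rewrite mem_iota ltn_mod.
apply/mapP; exists (x %/ p)%N; first by rewrite mem_iota.
by rewrite addnC mulnC -divn_eq.
Qed.

Lemma count_core_beads p X r : (r < p)%N ->
  count (fun x => x %% p == r)%N (undup (core_beads p X)) = count (fun x => x %% p == r)%N X.
Proof.
move=> rp; have p0 : (0 < p)%N by apply: leq_trans rp.
set c := count _ X; rewrite -size_filter.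
have -> : c = size [seq (r + p * k)%N | k <- iota 0 c] by rewrite size_map size_iota.
apply/perm_size/uniq_perm; first by rewrite filter_uniq ?undup_uniq.
  by rewrite map_inj_uniq ?iota_uniq // => a b /addnI /eqP; rewrite eqn_pmul2l // => /eqP.
move=> x; rewrite mem_filter mem_undup mem_core_beads //; apply/andP/mapP => [[/eqP xr]|[k]].
  rewrite xr -/c => lt; exists (x %/ p)%N; first by rewrite mem_iota.
  by rewrite {1}(divn_eq x p) xr addnC mulnC.
rewrite mem_iota => /andP[_ lt] ->; rewrite addnC mulnC divnMDl // divn_small // addn0 modnMDl.
by rewrite modn_small // eqxx.
Qed.

(* The beads at the 4K positions x - 2Ke, ..., x + (2K - 1)e congruent to x mod e. *)
Definition csum (e K : nat) (T : int -> bool) (x : int) : nat :=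
  count (fun l => T (e%:Z * (l%:Z - K.*2%:Z) + x)) (iota 0 (K.*2 + K.*2)).

Lemma csum_count e X u r : uniq X -> (r < e)%N -> exists K0, forall K, (K0 <= K)%N ->
  (csum e K (maya X) (e%:Z * u + r%:Z))%:Z = K.*2%:Z - u + (count (fun x => x %% e == r)%N X)%:Z.
Proof.
move=> uX re; exists (`|u| + \max_(x <- X) x + 1)%N => K le; rewrite /csum.
have e0 : (0 < e)%N by apply: leq_trans re.
(* [k] is the number of sampled positions that are negative, all of them filled; the remaining ones
   see the class of [r] in [X]. *)
pose k := `|(K.*2%:Z - u)%R|%N; have kE : k%:Z = K.*2%:Z - u by rewrite /k; lia.
have -> : (K.*2 + K.*2 = k + (K.*2 + K.*2 - k))%N by rewrite subnKC // /k; lia.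
rewrite iotaD count_cat add0n PoszD -kE; congr (Posz _ + Posz _).
  have -> : count (fun l : nat => maya X (e%:Z * (l%:Z - K.*2%:Z) + (e%:Z * u + r%:Z))) (iota 0 k) =
    size (iota 0 k).
    apply/eqP; rewrite -all_count; apply/allP => l; rewrite mem_iota => lt.
    by rewrite /maya; apply/orP; left; nia.
  by rewrite size_iota.
rewrite -!size_filter.
pose g l := (e * (l - k) + r)%N.
rewrite -(size_map g); apply/perm_size/uniq_perm.
- rewrite map_inj_in_uniq ?filter_uniq ?iota_uniq // => a b.
  rewrite !mem_filter !mem_iota => /andP[_ ha] /andP[_ hb] /addIn/eqP.
  by rewrite eqn_pmul2l // => /eqP; lia.
- by rewrite filter_uniq.
have gE l : (k <= l)%N -> e%:Z * (l%:Z - K.*2%:Z) + (e%:Z * u + r%:Z) = g l.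
  move=> kl; rewrite /g addrA -mulrDr; have -> : l%:Z - K.*2%:Z + u = (l - k)%N by lia.
  by rewrite PoszD PoszM.
move=> x; rewrite mem_filter; apply/mapP/andP => [[l]|[/eqP xr xX]].
  rewrite mem_filter mem_iota => /andP[h /andP[kl _]] ->; move: h; rewrite gE // /maya /= => h.
  by split=> //; rewrite /g mulnC modnMDl modn_small.
exists (k + x %/ e)%N; last by rewrite /g addKn -xr mulnC -divn_eq.
rewrite mem_filter gE ?leq_addr // /g addKn -xr mulnC -divn_eq /maya /= xX /= mem_iota.
rewrite leq_addr /=.
have : (x <= \max_(x <- X) x)%N by apply: (leq_bigmax_seq (F := id)).
have := leq_div x e; rewrite /k; lia.
Qed.

Lemma csum_core e X x : (0 < e)%N -> uniq X -> exists K0, forall K, (K0 <= K)%N ->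
  csum e K (maya X) x = csum e K (maya (core_beads e X)) x.
Proof.
move=> e0 uX.
have [u [r [re ->]]] : exists u r, (r < e)%N /\ x = e%:Z * u + r%:Z.
  exists (x %/ e%:Z)%Z, `|(x %% e%:Z)%Z|%N; split.
    by have := modz_ge0 x (d := e%:Z); have := ltz_pmod x (d := e%:Z); lia.
  by rewrite gez0_abs ?modz_ge0 //; [rewrite mulrC -divz_eq | lia].
have [K1 h1] := csum_count u uX re.
have [K2 h2] := csum_count u (undup_uniq (core_beads e X)) re.
exists (K1 + K2)%N => K le; have := h1 K; have := h2 K; rewrite count_core_beads // => E2 E1.
have -> : csum e K (maya (core_beads e X)) (e%:Z * u + r%:Z) =
  csum e K (maya (undup (core_beads e X))) (e%:Z * u + r%:Z).
  by apply: eq_count => l; rewrite /maya mem_undup.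
apply/eqP; rewrite -eqz_nat E1 ?E2 //; lia.
Qed.

Lemma maya_core_sub e X (x : int) (q : nat) : (0 < e)%N ->
  maya (core_beads e X) (x + e%:Z * q%:Z) -> maya (core_beads e X) x.
Proof.
move=> e0; rewrite /maya; case: (ltP x 0) => //= x0.
have -> : x + e%:Z * q%:Z < 0 = false by nia.
rewrite /= !mem_core_beads //.
have -> : `|(x + e%:Z * q%:Z)%R|%N = (q * e + `|x|)%N by nia.
by rewrite divnMDl // modnMDl; lia.
Qed.

Lemma maya_bounded X : exists M : nat, forall x : int, M%:Z <= x -> ~~ maya X x.
Proof.
exists (\max_(x <- X) x).+1 => x le; rewrite /maya negb_or -leNgt; apply/andP; split; first by lia.
apply/negP => h; have : (`|x| <= \max_(x <- X) x)%N by apply: (leq_bigmax_seq (F := id)).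
by lia.
Qed.

(** Sliding the sampled positions by [e] drops a filled one at the bottom and gains an empty one at
    the top. *)
Lemma csum_shift e X x : (0 < e)%N -> exists K0, forall K, (K0 <= K)%N ->
  csum e K (maya X) x = (csum e K (maya X) (x + e%:Z)).+1.
Proof.
move=> e0; have [M hM] := maya_bounded X; exists (`|x| + M + 1)%N => K le; rewrite /csum.
pose P l := maya X (e%:Z * (l%:Z - K.*2%:Z) + x).
have -> : count (fun l : nat => maya X (e%:Z * (l%:Z - K.*2%:Z) + (x + e%:Z))) (iota 0 (K.*2 + K.*2))
   = count P (iota 1 (K.*2 + K.*2)).
  rewrite -[1%N]/(1 + 0)%N iotaDl count_map; apply: eq_count => l; rewrite /P /=.
  by congr (maya X _); rewrite PoszD; lia.
rewrite -/P; set N := (K.*2 + K.*2)%N.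
have E1 : count P (iota 0 N.+1) = (P 0%N + count P (iota 1 N))%N by [].
have E2 : count P (iota 0 N.+1) = (count P (iota 0 N) + P N)%N.
  by rewrite -addn1 iotaD count_cat /= add0n addn0.
have P0 : P 0%N by rewrite /P /maya; apply/orP; left; nia.
have PN : P N = false by apply/negbTE/hM; rewrite /N; nia.
by move: E1; rewrite E2 P0 PN; lia.
Qed.

(* If x + 2 carries a bead and x does not, closure under -e puts more than 2K of the
   4K positions counted for x + 2 in the diagram, but at most 2K of those for x. *)
Lemma core_closed2 e X : (0 < e)%N ->
  (forall x, exists K0, forall K, (K0 <= K)%N ->
     (csum e K (maya (core_beads e X)) (x + 2) <= csum e K (maya (core_beads e X)) x)%N) ->
  forall x, maya (core_beads e X) (x + 2) -> maya (core_beads e X) x.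
Proof.
move=> e0 dom x h2; apply/negPn/negP => h0; have [K0 hK] := dom x.
pose K := K0.+1; have := hK K (leqnSn _).
rewrite leqNgt => /negP; apply; rewrite /csum.
apply: (@leq_ltn_trans K.*2).
  rewrite iotaD count_cat add0n -[leqRHS]addn0 leq_add //.
    by apply: leq_trans (count_size _ _) _; rewrite size_iota.
  rewrite leqn0 eqn0Ngt -has_count; apply/hasPn => l; rewrite mem_iota => /andP[kl _].
  apply: contra h0; have -> : e%:Z * (l%:Z - K.*2%:Z) + x = x + e%:Z * (l - K.*2)%N by nia.
  exact: maya_core_sub.
have -> : (K.*2 + K.*2 = K.*2.+1 + (K.*2.-1))%N by rewrite /K; lia.
rewrite iotaD count_cat; apply: leq_trans (leq_addr _ _).
set s := iota 0 _; rewrite [leqLHS](_ : _ = size s); last by rewrite size_iota.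
rewrite leq_eqVlt eq_sym -all_count; apply/orP; left; apply/allP => l; rewrite mem_iota => lt.
apply: (@maya_core_sub e X _ (K.*2 - l)) => //.
by have -> : e%:Z * (l%:Z - K.*2%:Z) + (x + 2) + e%:Z * (K.*2 - l)%N = x + 2 by nia.
Qed.

(* The Maya diagram of a 2-core Delta_s, up to translation. *)
Definition stair (T : int -> bool) (sigma : int) (s : nat) := forall q : int,
  T (sigma + 2 * q) = (q <= 0) /\ T (sigma + 1 + 2 * q) = (q <= s%:Z).

(** If the even runner is not longer, [sigma] is its last bead; otherwise [sigma] is the last bead
    of the odd runner. In the second case the neighbour [sigma + 1] lies one step further along its
    own runner, whence the extra -1. *)
Lemma stair_of_counts T (m0 m1 : nat) :
  (forall q : int, T (2 * q) = (q < m0%:Z) /\ T (2 * q + 1) = (q < m1%:Z)) ->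
  exists sigma, stair T sigma (if (m0 <= m1)%N then m1 - m0 else m0 - m1 - 1)%N.
Proof.
move=> h; case: leqP => le.
  exists (2 * (m0%:Z - 1)) => q; have [h1 _] := h (m0%:Z - 1 + q); have [_ h2] := h (m0%:Z - 1 + q).
  rewrite -mulrDr h1 (_ : 2 * (m0%:Z - 1) + 1 + 2 * q = 2 * (m0%:Z - 1 + q) + 1); last by lia.
  by rewrite h2; split; lia.
exists (2 * (m1%:Z - 1) + 1) => q; have [_ h1] := h (m1%:Z - 1 + q); have [h2 _] := h (m1%:Z + q).
rewrite (_ : 2 * (m1%:Z - 1) + 1 + 2 * q = 2 * (m1%:Z - 1 + q) + 1); last by lia.
rewrite h1 (_ : 2 * (m1%:Z - 1) + 1 + 1 + 2 * q = 2 * (m1%:Z + q)); last by lia.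
by rewrite h2; split; lia.
Qed.

Lemma threshold (P : nat -> bool) M : (forall n, P n.+1 -> P n) -> (forall n, (M <= n)%N -> ~~ P n) ->
  exists m, forall n, P n = (n < m)%N.
Proof.
move=> down bd; have ex : exists n, ~~ P n by exists M; apply: bd.
case: (ex_minnP ex) => m nm min; exists m => n; case: ltnP => [lt|ge].
  by apply/negPn/negP => /min; rewrite leqNgt lt.
elim: n ge => [|n IH]; first by rewrite leqn0 => /eqP m0; rewrite m0 in nm; apply: negbTE.
rewrite leq_eqVlt => /orP[/eqP <-|/IH pn]; first exact: negbTE.
by apply/negP => /down; rewrite pn.
Qed.

Lemma stair_exists X : (forall x, maya X (x + 2) -> maya X x) ->
  exists sigma s, stair (maya X) sigma s.
Proof.
move=> cl; have [M hM] := maya_bounded X.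
have [||m0 h0] := @threshold (fun n => maya X (2 * n%:Z)) M.
- by move=> n h; apply: cl; rewrite (_ : _ + 2 = 2 * n.+1%:Z) //; lia.
- by move=> n le; apply: hM; lia.
have [||m1 h1] := @threshold (fun n => maya X (2 * n%:Z + 1)) M.
- by move=> n h; apply: cl; rewrite (_ : _ + 2 = 2 * n.+1%:Z + 1) //; lia.
- by move=> n le; apply: hM; lia.
have [|sigma h] := @stair_of_counts (maya X) m0 m1; last by exists sigma; eexists; apply: h.
case=> q; first by rewrite h0 h1; split; lia.
by split; rewrite /maya (_ : (_ < 0) = true) //; lia.
Qed.

Lemma nth_Delta s a : nth 0%N (Delta s) a = (s - a)%N.
Proof.
rewrite /Delta; have [lt|ge] := ltnP a s.
  by rewrite nth_rev ?size_iota // nth_iota; lia.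
by rewrite nth_default ?size_rev ?size_iota //; lia.
Qed.

Lemma Delta_partition s : is_partition (Delta s).
Proof.
apply/andP; split.
  by apply/(sortedP 0%N) => i _; rewrite !nth_Delta /=; lia.
by apply/allP => x; rewrite mem_rev mem_iota => /andP[].
Qed.

Lemma Delta_inj : injective Delta.
Proof. by move=> s t /(congr1 size); rewrite !size_rev !size_iota. Qed.

Lemma bead_Delta s : stair (bead 0 (Delta s)) (- s%:Z - 1) s.
Proof.
move=> q; split; apply/beadP/idP.
- by case=> a; rewrite /bpos nth_Delta; lia.
- by move=> h; exists `|(s%:Z + 1 - 2 * q)%R|%N; rewrite /bpos nth_Delta; lia.
- by case=> a; rewrite /bpos nth_Delta; lia.
move=> h; case: (leP 0 q) => q0; [exists `|(s%:Z - q)%R|%N | exists `|(s%:Z - 2 * q)%R|%N];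
  rewrite /bpos nth_Delta; lia.
Qed.

Lemma parity_shift (sigma x : int) : exists q, x = sigma + 2 * q \/ x = sigma + 1 + 2 * q.
Proof.
exists ((x - sigma) %/ 2)%Z; have := divz_eq (x - sigma) 2.
have := ltz_pmod (x - sigma) (d := 2) isT; have := modz_ge0 (x - sigma) (d := 2) isT.
move: (_ %% _)%Z (_ %/ _)%Z => r q; lia.
Qed.

Lemma stair_Delta X sigma s : stair (maya X) sigma s -> part_of_beta X = Delta s.
Proof.
move=> h; pose n := size (undup X).
(* The charge absorbs the translation: [sigma - n + 1] in contents on the left, [- s - 1] for the
   staircase of charge 0. *)
suff : bead 0 (part_of_beta X) =1 bead (sigma - n%:Z + 2 + s%:Z) (Delta s).
  by move/(bead_charge_inj (part_of_beta_partition X) (Delta_partition s)) => [].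
move=> p; rewrite bead_part_of_beta -/n.
have -> : bead (sigma - n%:Z + 2 + s%:Z) (Delta s) p = bead 0 (Delta s) (p - (sigma - n%:Z + 2 + s%:Z)).
  by apply/beadP/beadP => -[a E]; exists a; move: E; rewrite /bpos; lia.
have [q [E|E]] := parity_shift sigma (p - 0 + n%:Z - 1); rewrite E.
  rewrite (h q).1 -(bead_Delta s q).1; congr bead; lia.
rewrite (h q).2 -(bead_Delta s q).2; congr bead; lia.
Qed.

(** * Weights *)

Lemma maya_even X y : maya [seq x./2 | x <- X & ~~ odd x] y = maya X (2 * y).
Proof.
rewrite /maya; case: (ltP y 0) => y0 /=; first by rewrite (_ : (2 * y < 0) = true) //; lia.
rewrite (_ : (2 * y < 0) = false) /=; last by lia.
have -> : `|(2 * y)%R|%N = (`|y|%N).*2 by lia.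
apply/mapP/idP => [[x]|h]; last by exists (`|y|%N).*2; rewrite ?mem_filter ?odd_double ?doubleK.
by rewrite mem_filter => /andP[ox xX] ->; rewrite even_halfK.
Qed.

Lemma maya_odd X y : maya [seq x.-1./2 | x <- X & odd x] y = maya X (2 * y + 1).
Proof.
rewrite /maya; case: (ltP y 0) => y0 /=; first by rewrite (_ : (2 * y + 1 < 0) = true) //; lia.
rewrite (_ : (2 * y + 1 < 0) = false) /=; last by lia.
have -> : `|(2 * y + 1)%R|%N = (`|y|%N).*2.+1 by lia.
apply/mapP/idP => [[x]|h].
  by rewrite mem_filter => /andP[ox xX] ->; case: x ox xX => //= x ox; rewrite even_halfK.
by exists (`|y|%N).*2.+1; rewrite ?mem_filter /= ?odd_double ?doubleK.
Qed.

Lemma size_even X : uniq X ->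
  size (undup [seq x./2 | x <- X & ~~ odd x]) = count (predC odd) X.
Proof.
move=> u; rewrite undup_id ?size_map ?size_filter // map_inj_in_uniq ?filter_uniq // => x y.
by rewrite !mem_filter => /andP[ox _] /andP[oy _] E; rewrite -(even_halfK ox) E even_halfK.
Qed.

Lemma size_odd X : uniq X -> size (undup [seq x.-1./2 | x <- X & odd x]) = count odd X.
Proof.
move=> u; rewrite undup_id ?size_map ?size_filter // map_inj_in_uniq ?filter_uniq // => x y.
rewrite !mem_filter => /andP[ox _] /andP[oy _]; case: x ox => // x; case: y oy => //= y oy ox E.
by rewrite -(even_halfK ox) E even_halfK.
Qed.

Lemma beta_setS n la : (size la <= n)%N ->
  beta_set n.+1 la = rcons [seq x.+1 | x <- beta_set n la] 0%N.
Proof.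
move=> le; rewrite /beta_set -addn1 iotaD map_cat add0n cats1; congr rcons; last first.
  by rewrite /= nth_default //; lia.
by rewrite -map_comp; apply/eq_in_map => i; rewrite mem_iota /=; lia.
Qed.

Definition odd_count la := count odd (beta_set (odd_beads la) la).
Definition even_count la := count (predC odd) (beta_set (odd_beads la) la).

Lemma core2_counts la t : core 2 la = Delta t ->
  let k0 := count (predC odd) (beta_set (size la) la) in
  let k1 := count odd (beta_set (size la) la) in
  t = if (k0 <= k1)%N then (k1 - k0)%N else (k0 - k1 - 1)%N.
Proof.
move=> core2 k0 k1; apply: Delta_inj; rewrite -core2.
have [|sigma h] := @stair_of_counts (maya (core_beads 2 (beta_set (size la) la))) k0 k1.
  have c0 : count (fun y => y %% 2 == 0)%N (beta_set (size la) la) = k0.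
    by apply: eq_count => y; rewrite modn2 /=; case: odd.
  have c1 : count (fun y => y %% 2 == 1)%N (beta_set (size la) la) = k1.
    by apply: eq_count => y; rewrite modn2 /=; case: odd.
  case=> q; last by split; rewrite /maya (_ : (_ < 0) = true) //; lia.
  rewrite /maya !mem_core_beads //.
  have -> : `|(2 * q%:Z)%R|%N = (q * 2)%N by lia.
  have -> : `|(2 * q%:Z + 1)%R|%N = (q * 2 + 1)%N by lia.
  rewrite mulnK // modnMl c0 divnMDl // modnMDl c1 addn0.
  by split; lia.
exact: stair_Delta h.
Qed.

(** With an odd total number of beads the two branches of [core2_counts] are told apart by the
    parity of [t]. This is why the quotient is swapped for odd [t]. *)
Lemma bead_counts la t : core 2 la = Delta t ->
  if odd t then odd_count la = (even_count la + t)%N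
  else even_count la = (odd_count la + t + 1)%N.
Proof.
move/core2_counts; set k0 := count _ _; set k1 := count _ _ => /= tE.
have kk : (k0 + k1 = size la)%N.
  by rewrite /k0 /k1 addnC count_predC size_map size_iota.
have parity := odd_double_half (size la); have parity_t := odd_double_half t.
rewrite /odd_count /even_count /odd_beads; case os: (odd (size la)) parity => parity.
  rewrite -/k0 -/k1; case: (odd t) parity_t => /=; move: tE; case: leqP; lia.
(* One more bead raises all others by one, exchanging the parities, and adds the even number 0. *)
rewrite beta_setS // -cats1 !count_cat.
have -> : count odd [seq x.+1 | x <- beta_set (size la) la] = k0.
  by rewrite count_map; apply: eq_count.
have -> : count (predC odd) [seq x.+1 | x <- beta_set (size la) la] = k1.
  by rewrite count_map; apply: eq_count => x; rewrite /= negbK.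
case: (odd t) parity_t => /=; move: tE; case: leqP; lia.
Qed.

Lemma barquot2_bipartition t la : is_bipartition (barquot2 t la).
Proof.
by rewrite /barquot2 /quot2 /is_bipartition; case: ifP => _ /=; rewrite !part_of_beta_partition.
Qed.

(* The two charged components of the quotient interleave to the Maya diagram of la,
   the charge making their residues mod e agree after doubling; this explains the
   summand (1 - e)/2 of the charge. *)
Lemma barquot2_cfg e t la : odd e -> is_partition la -> core 2 la = Delta t ->
  exists tau, forall p, let X := cfg (charge t e) (barquot2 t la) in
    X 1%N p = maya (beta_set (size la) la) (2 * p + tau) /\
    X 0%N p = maya (beta_set (size la) la) (2 * p + tau + e%:Z).
Proof.
move=> oe P /bead_counts; set n := size la.
have le : (n <= odd_beads la)%N by rewrite /odd_beads -/n; case: ifP.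
have u := beta_set_uniq P le.
have cE : forall c c', (forall p, bead c (quot2 la).1 p =
      maya (beta_set n la) (2 * (p - c + (even_count la)%:Z - 1) - (odd_beads la)%:Z + n%:Z)) /\
    (forall p, bead c' (quot2 la).2 p =
      maya (beta_set n la) (2 * (p - c' + (odd_count la)%:Z - 1) + 1 - (odd_beads la)%:Z + n%:Z)).
  move=> c c'; split=> p; rewrite /quot2 /= bead_part_of_beta.
    rewrite size_even // maya_even !maya_beta_set //; congr bead; rewrite /even_count; lia.
  rewrite size_odd // maya_odd !maya_beta_set //; congr bead; rewrite /odd_count; lia.
rewrite /cfg /barquot2 /charge; case: (odd t) => cnt.
  exists (2 * ((even_count la)%:Z - 1) - (odd_beads la)%:Z + n%:Z) => p /=.
  rewrite (cE 0 0).1 (cE 0 (t%:Z - (e.-1)./2%:Z)).2; split; congr maya; lia.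
exists (2 * ((odd_count la)%:Z - 1) + 1 - (odd_beads la)%:Z + n%:Z) => p /=.
rewrite (cE (t%:Z - (e.-1)./2%:Z) 0).1 (cE 0 0).2; split; congr maya; lia.
Qed.

Lemma count_double (P : pred nat) n : count P (iota 0 (n + n)) =
  (count (fun m => P m.*2) (iota 0 n) + count (fun m => P m.*2.+1) (iota 0 n))%N.
Proof.
elim: n => // n IH.
have -> : iota 0 (n.+1 + n.+1) = iota 0 (n + n) ++ [:: n.*2; n.*2.+1].
  by rewrite (_ : (n.+1 + n.+1 = (n + n) + 2)%N) ?iotaD -?addnn //; lia.
have -> : iota 0 n.+1 = iota 0 n ++ [:: n] by rewrite -addn1 iotaD.
rewrite !count_cat IH /= !addn0; lia.
Qed.

Lemma count_sites (P : pred site) e i K : count P (sites e i K) =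
  (count (fun m : nat => P ((e%:Z * (m%:Z - K%:Z) + i)%R, 0%N)) (iota 0 K.*2) +
   count (fun m : nat => P ((e%:Z * (m%:Z - K%:Z) + i)%R, 1%N)) (iota 0 K.*2))%N.
Proof.
rewrite /sites (permP (permEl (perm_sort _ _))).
by elim: (iota 0 K.*2) => //= m s IH; rewrite IH; lia.
Qed.

(** The sites of one colour in component 1 give the even indices of [csum], those in component 0 the
    odd ones. Hence 2K sites in each component become 4K positions with step [e]. *)
Lemma count_sites_csum (X : nat -> int -> bool) T tau e i K (b : int) :
  (forall p, X 1%N p = T (2 * p + tau) /\ X 0%N p = T (2 * p + tau + e%:Z)) ->
  count (fun s : site => X s.2 (s.1 + b)) (sites e i K) = csum e K T (2 * (i + b) + tau).
Proof.
move=> h; rewrite count_sites /csum count_double addnC; congr addn; apply: eq_count => m /=.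
  by rewrite (h _).1; congr T; lia.
by rewrite (h _).2; congr T; lia.
Qed.

(** At every site, A minus R equals the bead at the content minus the bead at the next one. So
    [phi - eps] compares two neighbouring classes of beads. *)
Lemma phi_csum d e i nu T tau : (0 < e)%N -> is_bipartition nu ->
  (forall p, cfg d nu 1%N p = T (2 * p + tau) /\ cfg d nu 0%N p = T (2 * p + tau + e%:Z)) ->
  exists K0, forall K, (K0 <= K)%N ->
  (phi d e i nu + csum e K T (2 * i + tau + 2) = eps d e i nu + csum e K T (2 * i + tau))%N.
Proof.
move=> e0 P h; have [K0 hK] := wide_exists d nu; exists (K0 + `|i|)%N => K le.
have [-> -> _] := phi_epsE e0 P (hK K i le).
set X := cfg d nu in h *.
pose P1 (s : site) := X s.2 (s.1 + 1); pose P0 (s : site) := X s.2 (s.1 + 0).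
have E0 : count P0 (sites e i K) = csum e K T (2 * (i + 0) + tau).
  exact: count_sites_csum h.
have E1 : count P1 (sites e i K) = csum e K T (2 * (i + 1) + tau).
  exact: count_sites_csum h.
rewrite addr0 in E0; rewrite (_ : 2 * i + tau + 2 = 2 * (i + 1) + tau); last by lia.
rewrite -E0 -E1; have := nA_nR_count (sA X) (sR X) (sites e i K).
suff : (count (sA X) (sites e i K) + count P1 (sites e i K) =
  count (sR X) (sites e i K) + count P0 (sites e i K))%N by lia.
elim: (sites e i K) => //= s l IH; rewrite /P0 /P1 addr0 /sA /sR.
move: IH; case: (X s.2 s.1) (X s.2 (s.1 + 1)) => [] []; rewrite /P0 /P1 /sA /sR /=; lia.
Qed.

Lemma crystal_reindex (I T : Type) (sm : rel I) (ad : I -> I -> nat) valid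
    (E : I -> T -> T -> Prop) ep ph (g : I -> I) :
  (forall i j, sm (g i) (g j) = sm i j) -> (forall i j, ad (g i) (g j) = ad i j) ->
  crystal sm ad valid E ep ph ->
  crystal sm ad valid (fun i => E (g i)) (fun i => ep (g i)) (fun i => ph (g i)).
Proof.
move=> gs ga [h1 h2 h3 h4 h5 h6 h7 h8 h9 h10 h11 h12 h13]; split.
- by move=> i; apply: h1.
- by move=> i; apply: h2.
- by move=> i; apply: h3.
- by move=> i j x y; rewrite -gs; apply: h4.
- by move=> i; apply: h5.
- by move=> i; apply: h6.
- by move=> i; apply: h7.
- by move=> i j x v; rewrite -gs; apply: h8.
- by move=> i j x v; rewrite -gs; apply: h9.
- by move=> i j x y; rewrite -gs -ga; apply: h10.
- by move=> i j w x z; rewrite -gs; apply: h11.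
- by move=> i j w x z; rewrite -gs; apply: h12.
- by move=> i j x y z; rewrite -gs; apply: h13.
Qed.

Lemma core_weights e t la : odd e -> (1 < e)%N -> is_partition la -> core 2 la = Delta t ->
  (forall i, eps (charge t e) e i (barquot2 t la) = 0%N) ->
  exists s, core e la = Delta s /\ exists dsh, forall i,
    phi (charge t e) e i (barquot2 t la) = phi (charge s e) e (i + dsh) ([::], [::]) /\
    eps (charge s e) e (i + dsh) ([::], [::]) = 0%N.
Proof.
move=> oe e1 P c2 hw; have e0 : (0 < e)%N by exact: ltnW.
set B := beta_set (size la) la; have uB : uniq B by apply: beta_set_uniq.
pose C := core_beads e B; have coreE : core e la = part_of_beta C by [].
have [tau cfE] := barquot2_cfg oe P c2.
have Pmu := barquot2_bipartition t la.
pose h := e./2; have eE : e = (h.*2 + 1)%N by rewrite -[LHS]odd_double_half oe addnC.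
have wt i : exists K0, forall K, (K0 <= K)%N ->
    (phi (charge t e) e i (barquot2 t la) + csum e K (maya C) (2 * i + tau + 2) =
     csum e K (maya C) (2 * i + tau))%N.
  have [K1 h1] := phi_csum i e0 Pmu cfE.
  have [K2 h2] := csum_core (2 * i + tau + 2) e0 uB.
  have [K3 h3] := csum_core (2 * i + tau) e0 uB.
  exists (K1 + K2 + K3)%N => K le; have := h1 K; rewrite hw h2 ?h3; try lia.
  by move=> -> //; lia.
(* The weights reach only [x] with the parity of [tau]. For the other parity [x + e] is used, and
   passing to it lowers both counts by one. *)
have dom x : exists K0, forall K, (K0 <= K)%N ->
    (csum e K (maya C) (x + 2) <= csum e K (maya C) x)%N.
  have [q [->|E]] := parity_shift tau x.
    have [K0 hK] := wt q; exists K0 => K /hK; rewrite (_ : 2 * q + tau = tau + 2 * q) => [<-|]; [exact: leq_addl | lia].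
  have xe : x + e%:Z = 2 * (q + h%:Z + 1) + tau by lia.
  have [K0 hK] := wt (q + h%:Z + 1); have [K1 h1] := csum_shift C x e0.
  have [K2 h2] := csum_shift C (x + 2) e0.
  exists (K0 + K1 + K2)%N => K le; rewrite h1 ?h2; try lia.
  have hk : (K0 <= K)%N by lia.
  have := hK K hk; rewrite -xe ltnS (_ : x + 2 + e%:Z = x + e%:Z + 2); last by lia.
  by move=> <-; apply: leq_addl.
have [sigma [s st]] := stair_exists (core_closed2 e0 dom).
exists s; split; first by rewrite coreE (stair_Delta st).
have cfY p : cfg (charge s e) ([::], [::]) 1%N p = maya C (2 * p + sigma) /\
    cfg (charge s e) ([::], [::]) 0%N p = maya C (2 * p + sigma + e%:Z).
  rewrite addrC (st p).1 (_ : sigma + 2 * p + e%:Z = sigma + 1 + 2 * (p + h%:Z)); last by lia.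
  rewrite (st (p + h%:Z)).2 /cfg /bead /charge /dcomp /part_comp /= ?in_nil ?orbF.
  have -> : (e.-1)./2 = h by lia.
  by split; lia.
have ep0 i : eps (charge s e) e i ([::], [::]) = 0%N.
  have [K0 hK] := wide_exists (charge s e) ([::], [::]).
  have [_ -> _] := phi_epsE e0 (isT : is_bipartition ([::], [::])) (hK (K0 + `|i|)%N i (leqnn _)).
  elim: (sites _ _ _) => //= x l ->; rewrite add0n; apply/eqP; rewrite subn_eq0.
  by rewrite /sR /cfg /bead; case: (x.2) => [|k]; rewrite /= ?in_nil ?orbF; case: (leP _ _); case: (leP _ _) => //=; lia.
have wtY j : exists K0, forall K, (K0 <= K)%N ->
    (phi (charge s e) e j ([::], [::]) + csum e K (maya C) (2 * j + sigma + 2) =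
     csum e K (maya C) (2 * j + sigma))%N.
  have [K1 h1] := phi_csum j e0 (isT : is_bipartition ([::], [::])) cfY.
  by exists K1 => K /h1; rewrite ep0.
(* The colour shift aligns the origins [tau] and [sigma]. If they differ in parity, [tau] is
   replaced by [tau + e], which the step over one period in [csum_shift] allows. *)
have [q [E|E]] := parity_shift sigma tau.
  exists q => i; split=> //; have [K1 h1] := wt i; have [K2 h2] := wtY (i + q).
  have := h1 (K1 + K2)%N (leq_addr _ _); have := h2 (K1 + K2)%N (leq_addl _ _).
  rewrite (_ : 2 * (i + q) + sigma = 2 * i + tau); last by lia.
  by move=> <- /addIn.
exists (q + h%:Z + 1) => i; split=> //; have [K1 h1] := wt i.
have [K2 h2] := wtY (i + (q + h%:Z + 1)).
have [K3 h3] := csum_shift C (2 * i + tau) e0; have [K4 h4] := csum_shift C (2 * i + tau + 2) e0.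
pose K := (K1 + K2 + K3 + K4)%N.
have g1 : (K1 <= K)%N by rewrite /K; lia.
have g2 : (K2 <= K)%N by rewrite /K; lia.
have g3 : (K3 <= K)%N by rewrite /K; lia.
have g4 : (K4 <= K)%N by rewrite /K; lia.
have := h1 K g1; have := h2 K g2; rewrite h3 // h4 //.
rewrite (_ : 2 * (i + (q + h%:Z + 1)) + sigma = 2 * i + tau + e%:Z); last by lia.
rewrite (_ : 2 * i + tau + 2 + e%:Z = 2 * i + tau + e%:Z + 2); last by lia.
by move=> <-; rewrite -addnS => /addIn.
Qed.

(** * The isomorphism of components *)

Section Component.
Variables (c s : int * int) (e : nat) (x y : bipart) (dsh : int).
Hypothesis e3 : (3 <= e)%N.
Hypotheses (vx : is_bipartition x) (vy : is_bipartition y).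
Hypothesis ex : forall i, eps c e i x = 0%N.
Hypothesis ey : forall i, eps s e (i + dsh) y = 0%N.
Hypothesis wt : forall i, phi c e i x = phi s e (i + dsh) y.

Let E i nu nu' := edge c e nu i nu'.
Let E' i nu nu' := edge s e nu (i + dsh) nu'.
Local Notation M := (parallel E E' x y).

Let C : crystal (same e) (adj e) is_bipartition E (eps c e) (phi c e).
Proof. exact: edge_crystal. Qed.

Let C' : crystal (same e) (adj e) is_bipartition E'
  (fun i => eps s e (i + dsh)) (fun i => phi s e (i + dsh)).
Proof.
have sm i j : same e (i + dsh) (j + dsh) = same e i j.
  by rewrite /same; congr ((_ %% _)%Z == 0); lia.
apply: (crystal_reindex (g := fun i => i + dsh) sm _ (edge_crystal s e3)) => i j.
by rewrite /adj (addrAC i) (addrAC j) !sm.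
Qed.

Let main n := parallel_main C C' vx vy ex ey wt n.
Let inj m n u v w := @parallel_inj _ _ _ _ _ _ _ _ _ _ _ _ _ C C' x y vx vy ex ey wt m n u v w.
Let wt' i : phi s e (i + dsh) y = phi c e i x. Proof. by rewrite wt. Qed.
Let inj' m n u v w := @parallel_inj _ _ _ _ _ _ _ _ _ _ _ _ _ C' C y x vy vx ey ex wt' m n u v w.

Lemma parallel_edge n u u' i v : M n u u' -> E i u v -> exists v', E' i u' v' /\ M n.+1 v v'.
Proof. by move=> m; apply: (step C C' vx vy (main n).1 m). Qed.

Lemma parallel_edge' n u u' i v' : M n u u' -> E' i u' v' -> exists v, E i u v /\ M n.+1 v v'.
Proof.
move=> m0 e'; have m := parallel_sym m0; have st : same_stats E' (fun i => eps s e (i + dsh))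
    (fun i => phi s e (i + dsh)) E (eps c e) (phi c e) y x n.
  by move=> a a' h j; have [-> ->] := (main n).1 _ _ (parallel_sym h) j.
have [v [uv m']] := step C' C vy vx st m e'.
by exists v; split=> //; apply: parallel_sym m'.
Qed.

(** The left members of parallel pairs are closed under edges in both directions, forwards by
    [parallel_edge] and backwards by lifting predecessors, so they exhaust the component. *)
Lemma component_parallel u : component c e x u <-> exists n u', M n u u'.
Proof.
split=> [[_ H]|[n [u' H]]].
  have closed a b : clos_refl_sym_trans bipart (fun a b => exists i, edge c e a i b) a b ->
      (exists n a', M n a a') <-> (exists n b', M n b b').
    elim=> {a b} [a b [i ab]|a|a b _ h|a b d _ h1 _ h2].
    - split=> -[n [a' m]].
        by have [b' [_ m']] := parallel_edge m ab; exists n.+1, b'.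
      by have [k [w' [_ m' _]]] := (main n).2.1 _ _ m i a ab; exists k, w'.
    - by [].
    - exact: iff_sym.
    - exact: iff_trans h1 h2.
  by apply/(closed _ _ H); exists 0%N, y; apply: parallel0.
split=> //; elim: H => [|m i a a' b b' _ IH ab _]; first exact: rst_refl.
by apply: rst_trans IH _; apply: rst_step; exists i.
Qed.

Lemma component_parallel' u' : component s e y u' <-> exists n u, M n u u'.
Proof.
split=> [[_ H]|[n [u H]]].
  have closed a b : clos_refl_sym_trans bipart (fun a b => exists i, edge s e a i b) a b ->
      (exists n z, M n z a) <-> (exists n z, M n z b).
    elim=> {a b} [a b [i ab]|a|a b _ h|a b d _ h1 _ h2].
    - have {}ab : E' (i - dsh) a b by rewrite /E' subrK.
      split=> -[n [z m]].
        by have [b' [_ m']] := parallel_edge' m ab; exists n.+1, b'.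
      have [k [w' [_ m' _]]] := (main n).2.2 _ _ (parallel_sym m) _ a ab.
      by exists k, w'; apply: parallel_sym m'.
    - by [].
    - exact: iff_sym.
    - exact: iff_trans h1 h2.
  by apply/(closed _ _ H); exists 0%N, x; apply: parallel0.
split=> //; elim: H => [|m i a a' b b' _ IH _ ab]; first exact: rst_refl.
by apply: rst_trans IH _; apply: rst_step; exists (i + dsh).
Qed.

(** Inside the component the partner is unique by [parallel_inj], so the choice is harmless; outside
    it the value is arbitrary. *)
Let f u := epsilon (inhabits u) (fun u' => exists n, M n u u').

Let fP u : component c e x u -> exists n, M n u (f u).
Proof.
move=> /component_parallel [n [u' m]].
by apply: (epsilon_spec (inhabits u) (fun u' => exists n, M n u u')); exists u', n.
Qed.

Lemma component_iso_of_weights : exists g, component_iso c s e x y g dsh.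
Proof.
exists f; split.
- by move=> u /fP [n m]; apply/component_parallel'; exists n, u.
- move=> u v /fP [n mu] /fP [m mv_] fuv; rewrite -fuv in mv_.
  by have [] := inj' (parallel_sym mu) (parallel_sym mv_).
- move=> u' /component_parallel' [n [u m]].
  have cu : component c e x u by apply/component_parallel; exists n, u'.
  by exists u => //; have [k m'] := fP cu; have [] := inj m' m.
move=> u v i cu cv; have [n mu] := fP cu; have [m mv_] := fP cv; split=> uv.
  have [v' [fuv' move_bead']] := parallel_edge mu uv.
  by have [_ ->] := inj mv_ move_bead'.
have [v' [uv' move_bead']] := parallel_edge' mu uv.
by have [_ ->] := inj' (parallel_sym mv_) (parallel_sym move_bead').
Qed.

End Component.

Theorem theorem7p8 (e t : nat) (la : seq nat) :
  odd e -> (1 < e)%N -> is_partition la -> core 2 la = Delta t ->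
  highest_weight (charge t e) e (barquot2 t la) ->
  exists s : nat,
    core e la = Delta s /\
    exists (f : bipart -> bipart) (dsh : int),
      component_iso (charge t e) (charge s e) e (barquot2 t la) ([::], [::]) f dsh.
Proof.
move=> oe e1 P c2 hw; have e3 : (3 <= e)%N by case: e oe e1 {hw} => [|[|[|]]].
have vmu := barquot2_bipartition t la.
have ep0 i : eps (charge t e) e i (barquot2 t la) = 0%N.
  (* A positive [eps] would yield an incoming edge, against highest weight. *)
  case: (posnP (eps (charge t e) e i (barquot2 t la))) => // h.
  by have [nu edge_nu] := edge_pred0 e3 vmu h; case: hw; exists nu, i.
have [s [coreE [dsh wt]]] := core_weights oe e1 P c2 ep0.
exists s; split=> //.
have [f iso] := @component_iso_of_weights (charge t e) (charge s e) e (barquot2 t la)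
  ([::], [::]) dsh e3 vmu isT ep0 (fun i => (wt i).2) (fun i => (wt i).1).
by exists f, dsh.
Qed.
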